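(* Let $g_0,g_\infty\in\mathbb C$, $g_1=-g_0-g_\infty$, and let $G(t,z)$ be the EGF of the GKP triangle $\left[\begin{array}{cc|c}-\tfrac12,&1&g_0\\ 1,&-1&g_\infty\end{array}\right]$ (the case $(r_0,r_1,r_\infty)=(\tfrac12,\tfrac12,0)$). Put $t_+=t$, $t_-=1-t$ and $$s_\pm=\Bigl[\sqrt{t_\pm}\cos\Bigl(\tfrac z2\sqrt{t_+t_-}\Bigr)\pm\sqrt{t_\mp}\sin\Bigl(\tfrac z2\sqrt{t_+t_-}\Bigr)\Bigr]^2 .$$ Then $s_++s_-=1$, the quotients $s_+/t_+$ and $s_-/t_-$ (after expanding the squares) are analytic at $(0,0)$ and equal $1$ at $z=0$, and near $(0,0)$ $$G(t,z)=\Bigl(\frac{s_+}{t_+}\Bigr)^{g_0}\Bigl(\frac{s_-}{t_-}\Bigr)^{g_1}$$ with principal branches.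
   Context: GKP triangle: for complex parameters $\alpha,\beta,\gamma,\alpha',\beta',\gamma'$, the array $T_{n,k}=\left[\begin{array}{cc|c}\alpha,&\beta&\gamma\\ \alpha',&\beta'&\gamma'\end{array}\right]_{n,k}$ is defined by $T_{0,0}=1$, $T_{n,k}=0$ if $n<0$, $k<0$ or $k>n$, and $T_{n+1,k+1}=[\alpha n+\beta(k+1)+\gamma]T_{n,k+1}+[\alpha' n+\beta' k+\gamma']T_{n,k}$ for $n\ge0$, $k\in\mathbb Z$; its EGF is $G(t,z)=\sum_{n\ge0}\sum_{k=0}^nT_{n,k}t^kz^n/n!$. *)

(* Defs.v *)
From Stdlib Require Import Reals.
From Coquelicot Require Import Coquelicot.

Open Scope C_scope.

Definition cexp (z : C) : C :=
  (exp (Re z) * cos (Im z), exp (Re z) * sin (Im z))%R.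
Definition ccos (z : C) : C := (cexp (Ci * z) + cexp (- (Ci * z))) / 2.
Definition csin (z : C) : C := (cexp (Ci * z) - cexp (- (Ci * z))) / (2 * Ci).

(** Principal argument in (-PI, PI] (the usual atan2), Arg 0 := 0. *)
Definition Arg (z : C) : R :=
  let x := Re z in let y := Im z in
  if Rlt_dec 0 x then atan (y / x)
  else if Rlt_dec x 0 then
         (if Rle_dec 0 y then atan (y / x) + PI else atan (y / x) - PI)%R
  else if Rlt_dec 0 y then (PI / 2)%R
  else if Rlt_dec y 0 then (- (PI / 2))%R
  else 0%R.

(** Principal logarithm (meaningful for z <> 0). *)
Definition Clog (z : C) : C := (ln (Cmod z), Arg z).

Definition cpow (w g : C) : C :=
  if Ceq_dec w 0 then 0 else cexp (g * Clog w).

Definition csqrt (z : C) : C :=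
  if Ceq_dec z 0 then 0 else cexp (Clog z / 2).

Definition nC (n : nat) : C := RtoC (INR n).

(** The GKP triangle [alpha, beta | gamma ; alpha', beta' | gamma']_{n,k},
    for n, k >= 0 (entries with k < 0 are 0):
    T_{0,k} = [k = 0],
    T_{n+1,0}   = (alpha n + gamma) T_{n,0},
    T_{n+1,j+1} = (alpha n + beta (j+1) + gamma) T_{n,j+1}
                  + (alpha' n + beta' j + gamma') T_{n,j}.
    (T_{n,k} = 0 for k > n follows from the recursion.) *)
Fixpoint gkp (a b c a' b' c' : C) (n k : nat) : C :=
  match n with
  | O => match k with O => 1 | S _ => 0 end
  | S m =>
    match k with
    | O => (a * nC m + c) * gkp a b c a' b' c' m O
    | S j => (a * nC m + b * nC (S j) + c) * gkp a b c a' b' c' m (S j)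
             + (a' * nC m + b' * nC j + c') * gkp a b c a' b' c' m j
    end
  end.

Definition egf_term (T : nat -> nat -> C) (t z : C) (n : nat) : C :=
  (sum_n (fun k => T n k * Cpow t k) n)
  * Cpow z n / RtoC (INR (Factorial.fact n)).

(** The double power series sum_{n,k} a n k t^k z^n converges absolutely
    at (t,z) with sum v (summed as an iterated series, which is legitimate
    under absolute convergence). *)
Definition dps_sum (a : nat -> nat -> C) (t z v : C) : Prop :=
  (exists A : nat -> R,
      (forall n, is_series (fun k => Cmod (a n k) * Cmod t ^ k * Cmod z ^ n)%R (A n))
      /\ ex_series A)
  /\ exists inner : nat -> C,
      (forall n, is_series (fun k => a n k * Cpow t k * Cpow z n) (inner n))
      /\ is_series inner v.

Definition tp (t : C) : C := t.
Definition tm (t : C) : C := 1 - t.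
Definition wz (t z : C) : C := z / 2 * csqrt (tp t * tm t).
Definition sp (t z : C) : C :=
  Cpow (csqrt (tp t) * ccos (wz t z) + csqrt (tm t) * csin (wz t z)) 2.
Definition sm (t z : C) : C :=
  Cpow (csqrt (tm t) * ccos (wz t z) - csqrt (tp t) * csin (wz t z)) 2.

(* Main.v *)
Require Import Defs.
From Stdlib Require Import Reals Lra Lia.
From Coquelicot Require Import Coquelicot.
Open Scope C_scope.

(** Write [u = t (1 - t)]. The egf [G] of the triangle solves [D G = (g0 + ginf t) G]
    for the derivation [D = (1 + (1/2 - t) z) d/dz - u d/dt], and a formal power
    series in [z] with [D E = c E] that vanishes at [z = 0] vanishes identically.
    Let [A = cos (z sqrt u) + (1/2 - t) sin (z sqrt u) / sqrt u]. Then
    [D A = (1/2 - t) A] and [D s_+ = 0], so [E = A dG/dz - (g0 + ginf s_+) G] is such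
    a series and [E = 0]: for fixed [t], [G] solves an ordinary differential equation
    in [z].

    The quotients [q_+ = s_+ / t_+] and [q_- = s_- / t_-] are themselves egfs of
    triangles of the family, with [(g0, ginf) = (1, -1)] and [(0, -1)], and satisfy
    [dq_+/dz = (1 - t) A], [dq_-/dz = - t A], [A^2 = q_+ q_-]; hence
    [q_+^g0 q_-^g1] solves the same equation. Convergence follows from
    [sum_k |T n k| <= K^n n!]. All equations in [z] are integrated along the real
    segment from [0] to [z], where a complex power series is a pair of real ones. *)

(** * Finite complex sums and derivatives of polynomials in [t] *)

Notation csum := (@sum_n C_AbelianMonoid).
Notation is_cderive f t l :=
  (@is_derive C_AbsRing C_NormedModule f t (l : C)).

(* Coquelicot's structures leave equations at types that only unfold to [C]. *)
Ltac cring := lazymatch goal with |- @eq _ ?a ?b => change (@eq C a b) end; ring.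

Lemma nC_S n : nC (S n) = nC n + 1.
Proof. unfold nC; now rewrite S_INR, RtoC_plus. Qed.

Lemma nC_S_neq_0 n : nC (S n) <> 0.
Proof. intros H; apply (not_0_INR (S n)); [easy | now apply RtoC_inj]. Qed.

Lemma csum_O f : csum f 0%nat = f 0%nat.
Proof. exact (sum_O f). Qed.

Lemma csum_S f n : csum f (S n) = csum f n + f (S n).
Proof. exact (sum_Sn f n). Qed.

Lemma csum_ext f g n :
  (forall k, (k <= n)%nat -> f k = g k) -> csum f n = csum g n.
Proof. exact (sum_n_ext_loc f g n). Qed.

Lemma sum_n_shift {G : AbelianMonoid} (f : nat -> G) n :
  sum_n f (S n) = plus (f 0%nat) (sum_n (fun k => f (S k)) n).
Proof.
  induction n as [|n IH].
  - now rewrite sum_Sn, !sum_O.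
  - now rewrite sum_Sn, IH, (sum_Sn (fun k => f (S k))), plus_assoc.
Qed.

Lemma csum_shift f n : csum f (S n) = f 0%nat + csum (fun k => f (S k)) n.
Proof. exact (sum_n_shift f n). Qed.

Lemma csum_plus f g n : csum (fun k => f k + g k) n = csum f n + csum g n.
Proof.
  induction n as [|n IH]; [now rewrite !csum_O | rewrite !csum_S, IH; cring].
Qed.

Lemma csum_mult_l c f n : csum (fun k => c * f k) n = c * csum f n.
Proof.
  induction n as [|n IH]; [now rewrite !csum_O | rewrite !csum_S, IH; cring].
Qed.

Lemma is_cderive_ext (f g : C -> C) t df dg :
  (forall s : C, f s = g s) -> df = dg -> is_cderive f t df -> is_cderive g t dg.
Proof. intros Hfg <-; apply is_derive_ext, Hfg. Qed.

Lemma is_cderive_unique (f g : C -> C) t (df dg : C) :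
  (forall s, f s = g s) -> is_cderive f t df -> is_cderive g t dg -> df = dg.
Proof.
  intros Hfg Hf Hg.
  rewrite <- (is_C_derive_unique _ _ _ Hg).
  symmetry; apply is_C_derive_unique.
  exact (is_derive_ext _ _ _ _ Hfg Hf).
Qed.

Lemma is_cderive_const (c t : C) : is_cderive (fun _ => c) t (RtoC 0).
Proof. exact (is_derive_const c t). Qed.

(* The uniform structures of the two modules differ, but their norms agree. *)
Lemma is_cderive_AbsRing (f : C -> C) t (l : C) :
  is_cderive f t l <->
  @is_derive C_AbsRing (AbsRing_NormedModule C_AbsRing) f t l.
Proof.
  split; intros [_ H]; (split; [|exact H]).
  - apply (is_linear_scal_l (K := C_AbsRing)
             (V := AbsRing_NormedModule C_AbsRing)).
  - apply (is_linear_scal_l (K := C_AbsRing) (V := C_NormedModule)).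
Qed.

Lemma is_cderive_id (t : C) : is_cderive (fun s => s) t (RtoC 1).
Proof. apply is_cderive_AbsRing; exact (is_derive_id (K := C_AbsRing) t). Qed.

Lemma is_cderive_plus (f g : C -> C) t (df dg : C) :
  is_cderive f t df -> is_cderive g t dg ->
  is_cderive (fun s => f s + g s) t (df + dg).
Proof. exact (is_derive_plus (V := C_NormedModule) f g t df dg). Qed.

Lemma is_cderive_mult (f g : C -> C) t (df dg : C) :
  is_cderive f t df -> is_cderive g t dg ->
  is_cderive (fun s => f s * g s) t (df * g t + f t * dg).
Proof.
  rewrite !is_cderive_AbsRing; intros Hf Hg.
  exact (is_derive_mult (K := C_AbsRing) f g t df dg Hf Hg Cmult_comm).
Qed.

Lemma is_cderive_csum (f df : nat -> C -> C) t n :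
  (forall k, is_cderive (f k) t (df k t)) ->
  is_cderive (fun s => csum (fun k => f k s) n) t (csum (fun k => df k t) n).
Proof.
  intros H; induction n as [|n IH].
  - refine (is_cderive_ext _ _ _ _ _ _ _ (H 0%nat));
      intros; now rewrite csum_O.
  - refine (is_cderive_ext _ _ _ _ _ _ _ (is_cderive_plus _ _ _ _ _ IH (H (S n))));
      intros; now rewrite csum_S.
Qed.

(** The derivative of [t^n] as the product rule produces it; this recursion avoids a truncated
    exponent [n - 1]. *)
Fixpoint dpow (n : nat) (t : C) : C :=
  match n with O => 0 | S m => Cpow t m + t * dpow m t end.

Lemma is_cderive_dpow n t : is_cderive (fun s => Cpow s n) t (dpow n t).
Proof.
  induction n as [|n IH].
  - exact (is_cderive_const 1 t).
  - refine (is_cderive_ext _ _ _ _ _ _ _ (is_cderive_mult _ _ _ _ _ (is_cderive_id t) IH)).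
    + now intros s.
    + simpl; cring.
Qed.

Lemma mult_dpow n t : t * dpow n t = nC n * Cpow t n.
Proof.
  induction n as [|n IH]; simpl dpow.
  - unfold nC; simpl; cring.
  - rewrite nC_S, Cpow_S, Cmult_plus_distr_l, IH; cring.
Qed.

(** * The first-order operator of the recursion *)

(* With [X = sum_n X_n(t) z^n], this says [D X = c X] for the derivation
   [D = (1 + (1/2 - t) z) d/dz - t (1 - t) d/dt]; the egf of the triangle
   satisfies it with [c = g0 + ginf t]. *)
Definition eigen (c : C -> C) (X : nat -> C -> C) : Prop :=
  exists dX : nat -> C -> C,
    (forall n t, is_cderive (X n) t (dX n t)) /\
    (forall n t, nC (S n) * X (S n) t + nC n * (1/2 - t) * X n t
                 - t * (1 - t) * dX n t = c t * X n t).

Lemma eigen_ext c c' X Y :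
  (forall t, c t = c' t) -> (forall n t, X n t = Y n t) -> eigen c X -> eigen c' Y.
Proof.
  intros Hc HX [dX [H1 H2]]; exists dX; split; intros n t.
  - exact (is_cderive_ext _ _ _ _ _ (HX n) eq_refl (H1 n t)).
  - rewrite <- Hc, <- !HX; apply H2.
Qed.

(** The relation expresses [X (S n)] through [X n] and its derivative in [t]. That derivative
    vanishes once [X n] vanishes at every [t], so the induction carries all [t] at once. *)
Lemma eigen_vanish c X :
  eigen c X -> (forall t, X 0%nat t = 0) -> forall n t, X n t = 0.
Proof.
  intros [dX [H1 H2]] H0 n; induction n as [|n IH]; intros t; [apply H0|].
  assert (Hd : dX n t = 0)
    by exact (is_cderive_unique _ _ _ _ _ IH (H1 n t) (is_cderive_const 0 t)).
  generalize (H2 n t); rewrite Hd, IH; intros E.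
  destruct (Ceq_dec (X (S n) t) 0) as [|Hn]; [easy|].
  exfalso; apply (Cmult_neq_0 _ _ (nC_S_neq_0 n) Hn).
  transitivity (nC (S n) * X (S n) t + nC n * (1 / 2 - t) * 0 - t * (1 - t) * 0);
    [cring | rewrite E; cring].
Qed.

Lemma eigen_lin a b c X Y :
  eigen c X -> eigen c Y -> eigen c (fun n t => a * X n t + b * Y n t).
Proof.
  intros [dX [H1 H2]] [dY [K1 K2]].
  exists (fun n t => a * dX n t + b * dY n t); split; intros n t.
  - refine (is_cderive_ext _ _ _ _ _ _ _ (is_cderive_plus _ _ _ _ _
      (is_cderive_mult _ _ _ _ _ (is_cderive_const a t) (H1 n t))
      (is_cderive_mult _ _ _ _ _ (is_cderive_const b t) (K1 n t)))).
    + now intros s.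
    + cring.
  - transitivity (a * (c t * X n t) + b * (c t * Y n t)); [|cring].
    rewrite <- H2, <- K2; cring.
Qed.

Definition dz (X : nat -> C -> C) (n : nat) (t : C) : C := nC (S n) * X (S n) t.

(** Differentiate [D X = c X] in [z]: the commutator of [d/dz] with [D] is [(1/2 - t) d/dz], coming
    from the term [(1/2 - t) z d/dz]. *)
Lemma eigen_dz c X : eigen c X -> eigen (fun t => c t - (1/2 - t)) (dz X).
Proof.
  intros [dX [H1 H2]].
  exists (fun n t => nC (S n) * dX (S n) t); unfold dz; split; intros n t.
  - refine (is_cderive_ext _ _ _ _ _ _ _
      (is_cderive_mult _ _ _ _ _ (is_cderive_const (nC (S n)) t) (H1 (S n) t))).
    + now intros s.
    + cring.
  - transitivity (nC (S n) * (c t * X (S n) t) - nC (S n) * (1/2 - t) * X (S n) t);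
      [|cring].
    rewrite <- H2, (nC_S n); cring.
Qed.

(** * Cauchy products *)

Definition conv (x y : nat -> C) (n : nat) : C :=
  csum (fun k => x k * y (n - k)%nat) n.

(** Leibniz rule for [d/dz]: the weight [n + 1] splits as [k + (n + 1 - k)]. *)
Lemma conv_dz (x y : nat -> C) n :
  nC (S n) * conv x y (S n) =
  conv (fun k => nC (S k) * x (S k)) y n + conv x (fun k => nC (S k) * y (S k)) n.
Proof.
  unfold conv; rewrite <- csum_mult_l.
  transitivity (csum (fun k => nC k * x k * y (S n - k)%nat) (S n)
                + csum (fun k => nC (S n - k) * x k * y (S n - k)%nat) (S n)).
  - rewrite <- csum_plus; apply csum_ext; intros k Hk.
    replace (nC (S n)) with (nC k + nC (S n - k)); [cring|].
    unfold nC; rewrite <- RtoC_plus, <- plus_INR; repeat f_equal; lia.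
  (* The terms of weight zero drop out: [k = 0] in the first sum, [k = n + 1] in the second. *)
  - rewrite csum_shift, csum_S, Nat.sub_diag.
    transitivity (csum (fun k => nC (S k) * x (S k) * y (n - k)%nat) n
       + csum (fun k => nC (S n - k) * x k * y (S n - k)%nat) n).
    + change (nC 0) with (RtoC 0); simpl Nat.sub; cring.
    + f_equal; apply csum_ext; intros k Hk.
      rewrite (Nat.sub_succ_l k n) by easy; cring.
Qed.

(** Leibniz rule for the Euler operator [z d/dz]. *)
Lemma conv_nC (x y : nat -> C) n :
  nC n * conv x y n =
  conv (fun k => nC k * x k) y n + conv x (fun k => nC k * y k) n.
Proof.
  unfold conv; rewrite <- csum_mult_l, <- csum_plus; apply csum_ext; intros k Hk.
  replace (nC n) with (nC k + nC (n - k)); [cring|].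
  unfold nC; rewrite <- RtoC_plus, <- plus_INR; repeat f_equal; lia.
Qed.

(** [D] is a derivation, so the eigenvalues of the factors of a product add up. *)
Lemma eigen_conv c d X Y :
  eigen c X -> eigen d Y ->
  eigen (fun t => c t + d t) (fun n t => conv (fun k => X k t) (fun k => Y k t) n).
Proof.
  intros [dX [H1 H2]] [dY [K1 K2]].
  exists (fun n t => conv (fun k => dX k t) (fun k => Y k t) n
                     + conv (fun k => X k t) (fun k => dY k t) n).
  split; intros n t.
  - unfold conv; rewrite <- csum_plus.
    apply (is_cderive_csum (fun k s => X k s * Y (n - k)%nat s)
      (fun k s => dX k s * Y (n - k)%nat s + X k s * dY (n - k)%nat s)).
    intros k; now apply is_cderive_mult.
  - rewrite conv_dz.
    replace (nC n * (1 / 2 - t) * conv (fun k => X k t) (fun k => Y k t) n)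
      with ((1 / 2 - t) * (nC n * conv (fun k => X k t) (fun k => Y k t) n)) by cring.
    rewrite conv_nC; unfold conv.
    assert (Hminus : forall a b x : C, a - b * x = a + (- b) * x) by (intros; cring).
    rewrite Hminus, <- !csum_plus, <- !csum_mult_l, <- !csum_plus.
    apply csum_ext; intros k _.
    transitivity ((c t * X k t) * Y (n - k)%nat t + X k t * (d t * Y (n - k)%nat t));
      [|cring].
    rewrite <- H2, <- K2; cring.
Qed.

(** * The triangle and its formal differential equation *)

Notation tri g0 ginf := (gkp (- (1/2)) 1 g0 1 (-1) ginf).

Lemma gkp_above a b c a' b' c' n k : (n < k)%nat -> gkp a b c a' b' c' n k = 0.
Proof.
  revert k; induction n as [|n IH]; intros [|k] Hk; try lia; simpl; [easy|].
  rewrite !IH by lia; cring.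
Qed.

Definition factC (n : nat) : C := RtoC (INR (Factorial.fact n)).

Lemma factC_S n : factC (S n) = nC (S n) * factC n.
Proof. unfold factC, nC; now rewrite <- RtoC_mult, <- mult_INR. Qed.

Lemma factC_neq_0 n : factC n <> 0.
Proof. intros H; apply (INR_fact_neq_0 n); now apply RtoC_inj. Qed.

Definition row (g0 ginf : C) (n : nat) (t : C) : C :=
  csum (fun k => tri g0 ginf n k * Cpow t k) n.

Definition drow (g0 ginf : C) (n : nat) (t : C) : C :=
  csum (fun k => tri g0 ginf n k * dpow k t) n.

Lemma row_O g0 ginf t : row g0 ginf 0 t = 1.
Proof. unfold row; rewrite csum_O; simpl; cring. Qed.

Lemma is_cderive_row g0 ginf n t : is_cderive (row g0 ginf n) t (drow g0 ginf n t).
Proof.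
  unfold row, drow.
  apply (is_cderive_csum (fun k s => tri g0 ginf n k * Cpow s k)
           (fun k s => tri g0 ginf n k * dpow k s)).
  intros k; refine (is_cderive_ext _ _ _ _ _ _ _ (is_cderive_mult _ _ _ _ _
     (is_cderive_const (tri g0 ginf n k) t) (is_cderive_dpow k t))).
  - now intros s.
  - cring.
Qed.

(** The recursion summed against [t^k]: a factor [k] becomes [t d/dt], and the shift from [k] to
    [k + 1] becomes a factor [t]. *)
Lemma row_S g0 ginf n t :
  row g0 ginf (S n) t =
  (nC n * (t - 1/2) + g0 + ginf * t) * row g0 ginf n t
  + t * (1 - t) * drow g0 ginf n t.
Proof.
  transitivity
    (csum (fun k => (- (1/2) * nC n + nC k + g0) * (tri g0 ginf n k * Cpow t k)) n
     + csum (fun k => (nC n - nC k + ginf) * (tri g0 ginf n k * Cpow t (S k))) n).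
  - transitivity
      (csum (fun k => (- (1/2) * nC n + nC k + g0) * (tri g0 ginf n k * Cpow t k)) (S n)
       + csum (fun k => (nC n - nC k + ginf) * (tri g0 ginf n k * Cpow t (S k))) n).
    + unfold row; rewrite !csum_shift, <- Cplus_assoc, <- csum_plus; f_equal.
      * simpl; change (nC 0) with (RtoC 0); cring.
      * apply csum_ext; intros k _; simpl gkp; cring.
    (* Entry [n + 1] of row [n] is zero, which removes the extra term of the first sum. *)
    + rewrite csum_S, gkp_above by lia; cring.
  - unfold row, drow; rewrite <- (csum_mult_l _ _ n), <- (csum_mult_l (t * (1 - t))).
    rewrite <- !csum_plus; apply csum_ext; intros k _.
    replace (t * (1 - t) * (tri g0 ginf n k * dpow k t))
      with ((1 - t) * tri g0 ginf n k * (t * dpow k t)) by cring.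
    rewrite mult_dpow, Cpow_S; cring.
Qed.

Definition egf (g0 ginf : C) (n : nat) (t : C) : C := row g0 ginf n t / factC n.

Lemma eigen_egf g0 ginf : eigen (fun t => g0 + ginf * t) (egf g0 ginf).
Proof.
  exists (fun n t => drow g0 ginf n t / factC n); split; intros n t.
  - refine (is_cderive_ext _ _ _ _ _ _ _ (is_cderive_mult _ _ _ _ _
      (is_cderive_const (/ factC n) t) (is_cderive_row g0 ginf n t))).
    + intros s; unfold egf, Cdiv; cring.
    + unfold Cdiv; cring.
  - unfold egf; rewrite row_S, factC_S.
    field; split; [apply factC_neq_0 | apply nC_S_neq_0].
Qed.

(** * The series of [A], [q_+] and [q_-] *)

(* Derivatives at [z = 0] of [cos (z q) + (1/2 - t) sin (z q) / q],
   where [q^2 = t (1 - t)]. *)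
Fixpoint acoef (n : nat) (t : C) : C :=
  match n with
  | O => 1
  | S O => 1/2 - t
  | S (S m) => - (t * (1 - t)) * acoef m t
  end.

Lemma nat_ind2 (P : nat -> Prop) :
  P 0%nat -> P 1%nat -> (forall n, P n -> P (S n) -> P (S (S n))) -> forall n, P n.
Proof.
  intros H0 H1 HS n; cut (P n /\ P (S n)); [easy|].
  induction n as [|n [IH IH']]; auto.
Qed.

(** The second identity is [D A = (1/2 - t) A] multiplied by [n!]. The derivative [d] enters later
    computations only through [t (1 - t) d]. *)
Lemma is_cderive_acoef n t :
  exists d : C, is_cderive (acoef n) t d /\
    t * (1 - t) * d = acoef (S n) t + (nC n - 1) * (1/2 - t) * acoef n t.
Proof.
  assert (Hlin : forall c : C, is_cderive (fun s => c - s) t (-(1))).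
  { intros c; refine (is_cderive_ext _ _ _ _ _ _ _ (is_cderive_plus _ _ _ _ _
      (is_cderive_const c t)
      (is_cderive_mult _ _ _ _ _ (is_cderive_const (-(1)) t) (is_cderive_id t)))).
    - intros s; cring.
    - cring. }
  revert n; apply nat_ind2.
  - exists 0; split; [exact (is_cderive_const 1 t)|].
    simpl; change (nC 0) with (RtoC 0); cring.
  - exists (-(1)); split; [exact (Hlin (1/2))|].
    simpl; change (nC 1) with (RtoC 1); cring.
  - intros n [d [Hd E]] _.
    exists (- (1 - 2 * t) * acoef n t + - (t * (1 - t)) * d); split.
    + refine (is_cderive_ext _ _ _ _ _ _ _ (is_cderive_mult _ _ _ _ _
        (is_cderive_mult _ _ _ _ _ (is_cderive_const (-(1)) t)
          (is_cderive_mult _ _ _ _ _ (is_cderive_id t) (Hlin 1))) Hd)).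
      * intros s; simpl; cring.
      * cring.
    + transitivity (- (t * (1 - t)) * ((1 - 2 * t) * acoef n t + t * (1 - t) * d));
        [cring|].
      rewrite E; change (acoef (S (S (S n))) t) with (- (t * (1 - t)) * acoef (S n) t).
      change (acoef (S (S n)) t) with (- (t * (1 - t)) * acoef n t).
      rewrite !nC_S; field.
Qed.

(** On coefficients, [dq_+/dz = (1 - t) A]. The induction hypothesis holds for every [t], so it can
    be differentiated to obtain [drow], which [row_S] requires. *)
Lemma row_qp n t : row 1 (-1) (S n) t = (1 - t) * acoef n t.
Proof.
  revert t; induction n as [|n IH]; intros t.
  - rewrite row_S, row_O; unfold drow; rewrite csum_O; simpl.
    change (nC 0) with (RtoC 0); cring.
  - destruct (is_cderive_acoef n t) as [d [Hd E]].
    assert (Hrow : drow 1 (-1) (S n) t = - acoef n t + (1 - t) * d).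
    { apply (is_cderive_unique _ _ t _ _ IH (is_cderive_row 1 (-1) (S n) t)).
      refine (is_cderive_ext _ _ _ _ _ _ _ (is_cderive_mult _ _ _ _ _
        (is_cderive_plus _ _ _ _ _ (is_cderive_const 1 t)
          (is_cderive_mult _ _ _ _ _ (is_cderive_const (-(1)) t) (is_cderive_id t)))
        Hd)).
      - intros s; cring.
      - cring. }
    rewrite row_S, Hrow, IH.
    transitivity ((nC (S n) * (t - 1 / 2) + (1 - t)) * ((1 - t) * acoef n t)
      - t * (1 - t) * acoef n t + (1 - t) * (t * (1 - t) * d)); [cring|].
    rewrite E, nC_S; field.
Qed.

Lemma row_qm n t : row 0 (-1) (S n) t = - t * acoef n t.
Proof.
  revert t; induction n as [|n IH]; intros t.
  - rewrite row_S, row_O; unfold drow; rewrite csum_O; simpl.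
    change (nC 0) with (RtoC 0); cring.
  - destruct (is_cderive_acoef n t) as [d [Hd E]].
    assert (Hrow : drow 0 (-1) (S n) t = - acoef n t - t * d).
    { apply (is_cderive_unique _ _ t _ _ IH (is_cderive_row 0 (-1) (S n) t)).
      refine (is_cderive_ext _ _ _ _ _ _ _ (is_cderive_mult _ _ _ _ _
          (is_cderive_mult _ _ _ _ _ (is_cderive_const (-(1)) t) (is_cderive_id t))
        Hd)).
      - intros s; cring.
      - cring. }
    rewrite row_S, Hrow, IH.
    transitivity ((nC (S n) * (t - 1 / 2) - t) * (- t * acoef n t)
      - t * (1 - t) * acoef n t - t * (t * (1 - t) * d)); [cring|].
    rewrite E, nC_S; field.
Qed.

Definition acf (n : nat) (t : C) : C := acoef n t / factC n.

Lemma eigen_acf : eigen (fun t => 1/2 - t) acf.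
Proof.
  (* [C_derive] turns the pointwise existence of derivatives into the function that [eigen] asks
     for. *)
  set (da n t := (C_derive (acoef n) t)).
  assert (Hda : forall n t, is_cderive (acoef n) t (da n t) /\
    t * (1 - t) * da n t = acoef (S n) t + (nC n - 1) * (1/2 - t) * acoef n t).
  { intros n t; destruct (is_cderive_acoef n t) as [d [Hd E]]; unfold da.
    now rewrite (is_C_derive_unique _ _ _ Hd). }
  exists (fun n t => / factC n * da n t); split; intros n t;
    destruct (Hda n t) as [Hd E].
  - refine (is_cderive_ext _ _ _ _ _ _ _ (is_cderive_mult _ _ _ _ _
      (is_cderive_const (/ factC n) t) Hd)).
    + intros s; unfold acf, Cdiv; cring.
    + cring.
  - replace (t * (1 - t) * (/ factC n * da n t))
      with (/ factC n * (t * (1 - t) * da n t)) by cring.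
    rewrite E; unfold acf; rewrite factC_S.
    field; split; [apply factC_neq_0 | apply nC_S_neq_0].
Qed.

Lemma egf_O g0 ginf t : egf g0 ginf 0 t = 1.
Proof. unfold egf; rewrite row_O; unfold factC; simpl; field. Qed.

Lemma dz_egf_qp n t : dz (egf 1 (-1)) n t = (1 - t) * acf n t.
Proof.
  unfold dz, egf, acf; rewrite row_qp, factC_S.
  field; split; [apply factC_neq_0 | apply nC_S_neq_0].
Qed.

Lemma dz_egf_qm n t : dz (egf 0 (-1)) n t = - t * acf n t.
Proof.
  unfold dz, egf, acf; rewrite row_qm, factC_S.
  field; split; [apply factC_neq_0 | apply nC_S_neq_0].
Qed.

Definition one_coef (n : nat) : C := match n with O => 1 | S _ => 0 end.

(** [dA/dz = 1/2 - s_+]: both sides are [1/2 - t] at [z = 0], and both have derivative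
    [- t (1 - t) A]. *)
Lemma dz_acf n t :
  dz acf n t = 1/2 * one_coef n - t * egf 1 (-1) n t.
Proof.
  destruct n as [|n].
  - rewrite egf_O; unfold dz, acf, nC, factC; simpl; field.
  - unfold dz, acf, egf; rewrite row_qp, !factC_S; simpl acoef; simpl one_coef.
    field; repeat split; (apply factC_neq_0 || apply nC_S_neq_0).
Qed.

(** The series of [g0 + ginf s_+]. *)
Definition bcoef (g0 ginf : C) (n : nat) (t : C) : C :=
  g0 * one_coef n + ginf * (t * egf 1 (-1) n t).

(* [t * egf 1 (-1)] is [s_+], a first integral of the operator. *)
Lemma eigen_bcoef g0 ginf : eigen (fun _ => 0) (bcoef g0 ginf).
Proof.
  apply eigen_lin.
  - exists (fun _ _ => 0); split; intros n t.
    + exact (is_cderive_const (one_coef n) t).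
    + destruct n; simpl; change (nC 0) with (RtoC 0); cring.
  - destruct (eigen_egf 1 (-1)) as [dX [H1 H2]].
    exists (fun n t => egf 1 (-1) n t + t * dX n t); split; intros n t.
    + refine (is_cderive_ext _ _ _ _ _ _ _ (is_cderive_mult _ _ _ _ _
        (is_cderive_id t) (H1 n t))).
      * now intros s.
      * cring.
    (* [D t = - t (1 - t)] and [D q_+ = (1 - t) q_+], so the two contributions to [D (t q_+)]
       cancel. *)
    + transitivity (t * (nC (S n) * egf 1 (-1) (S n) t
        + nC n * (1 / 2 - t) * egf 1 (-1) n t - t * (1 - t) * dX n t)
        - t * (1 - t) * egf 1 (-1) n t); [cring|].
      rewrite H2; cring.
Qed.

(** Both sides have eigenvalue [g0 + ginf t]: on the left the [1/2 - t] of [A] cancels the shift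
    caused by [d/dz], on the right the first integral contributes [0]. *)
Lemma egf_ode g0 ginf n t :
  conv (fun k => acf k t) (fun k => dz (egf g0 ginf) k t) n =
  conv (fun k => bcoef g0 ginf k t) (fun k => egf g0 ginf k t) n.
Proof.
  set (L n t := conv (fun k => acf k t) (fun k => dz (egf g0 ginf) k t) n).
  set (M n t := conv (fun k => bcoef g0 ginf k t) (fun k => egf g0 ginf k t) n).
  assert (HL : eigen (fun t => g0 + ginf * t) L).
  { refine (eigen_ext _ _ _ _ _ _ (eigen_conv _ _ _ _ eigen_acf
      (eigen_dz _ _ (eigen_egf g0 ginf)))); [intros; cring | easy]. }
  assert (HM : eigen (fun t => g0 + ginf * t) M).
  { refine (eigen_ext _ _ _ _ _ _ (eigen_conv _ _ _ _ (eigen_bcoef g0 ginf)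
      (eigen_egf g0 ginf))); [intros; cring | easy]. }
  (* Both constant terms are [g0 + ginf t]. *)
  assert (H0 : forall t, 1 * L 0%nat t + (-(1)) * M 0%nat t = 0).
  { intros s; unfold L, M, conv; rewrite !csum_O; unfold bcoef, dz, acf, egf.
    simpl Nat.sub; rewrite !row_S, !row_O; unfold drow; rewrite !csum_O.
    unfold factC, nC; simpl; field. }
  generalize (eigen_vanish _ _ (eigen_lin 1 (-(1)) _ _ _ HL HM) H0 n t).
  fold (L n t) (M n t); intros E.
  transitivity (1 * L n t + (-(1)) * M n t + M n t); [cring | rewrite E; cring].
Qed.

(** * Convergence *)

Definition rownorm (g0 ginf : C) (n : nat) : R :=
  sum_n (fun k => Cmod (tri g0 ginf n k)) n.

Lemma Cmod_nC n : Cmod (nC n) = INR n.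
Proof. unfold nC; rewrite Cmod_R; apply Rabs_pos_eq, pos_INR. Qed.

Lemma Cmod_half : Cmod (1/2) = (1/2)%R.
Proof. rewrite <- RtoC_div, Cmod_R by lra; apply Rabs_pos_eq; lra. Qed.

(** The factor grows with [k], but the entry vanishes for [k > n]; for [k <= n] the factor is at
    most [n/2 + n + |g0|] in modulus. *)
Lemma tri_coef_left_bound g0 ginf n k :
  (Cmod ((- (1/2) * nC n + 1 * nC k + g0) * tri g0 ginf n k)
   <= (3/2 * INR n + Cmod g0) * Cmod (tri g0 ginf n k))%R.
Proof.
  destruct (Nat.lt_ge_cases n k) as [Hk|Hk].
  - rewrite gkp_above by easy; rewrite Cmult_0_r, Cmod_0; lra.
  - rewrite Cmod_mult; apply Rmult_le_compat_r; [apply Cmod_ge_0|].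
    eapply Rle_trans; [apply Cmod_triangle|]; apply Rplus_le_compat_r.
    eapply Rle_trans; [apply Cmod_triangle|].
    rewrite !Cmod_mult, Cmod_opp, Cmod_half, Cmod_1, !Cmod_nC.
    apply le_INR in Hk; lra.
Qed.

Lemma tri_coef_right_bound g0 ginf n k :
  (Cmod ((1 * nC n + (-1) * nC k + ginf) * tri g0 ginf n k)
   <= (2 * INR n + Cmod ginf) * Cmod (tri g0 ginf n k))%R.
Proof.
  destruct (Nat.lt_ge_cases n k) as [Hk|Hk].
  - rewrite gkp_above by easy; rewrite Cmult_0_r, Cmod_0; lra.
  - rewrite Cmod_mult; apply Rmult_le_compat_r; [apply Cmod_ge_0|].
    eapply Rle_trans; [apply Cmod_triangle|]; apply Rplus_le_compat_r.
    eapply Rle_trans; [apply Cmod_triangle|].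
    rewrite !Cmod_mult, (Cmod_R (-1)), Cmod_1, !Cmod_nC, (Rabs_left (-1)) by lra.
    apply le_INR in Hk; lra.
Qed.

(** The two terms of the recursion contribute [3/2 n + |g0|] and [2 n + |ginf|]; the total [7/2 n]
    is rounded up to [4 n]. *)
Lemma rownorm_S g0 ginf n :
  (rownorm g0 ginf (S n)
   <= (4 * INR n + Cmod g0 + Cmod ginf) * rownorm g0 ginf n)%R.
Proof.
  set (a := (3/2 * INR n + Cmod g0)%R); set (b := (2 * INR n + Cmod ginf)%R).
  set (c k := Cmod (tri g0 ginf n k)).
  assert (Hpos : (0 <= rownorm g0 ginf n)%R).
  { unfold rownorm; replace 0%R with (sum_n (fun _ => 0%R) n)
      by (rewrite sum_n_const; apply Rmult_0_r).
    apply sum_n_m_le; intros; apply Cmod_ge_0. }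
  apply Rle_trans with (a * sum_n c (S n) + b * sum_n c n)%R.
  - unfold rownorm; rewrite !sum_n_shift.
    apply Rle_trans with
      (a * c 0%nat + sum_n (fun k => a * c (S k) + b * c k)%R n)%R.
    + apply Rplus_le_compat.
      * unfold a, c; eapply Rle_trans; [|apply (tri_coef_left_bound g0 ginf n 0)].
        apply Req_le; f_equal; simpl; change (nC 0) with (RtoC 0).
        f_equal; cring.
      * apply sum_n_m_le; intros k; simpl.
        eapply Rle_trans; [apply Cmod_triangle|]; apply Rplus_le_compat.
        -- apply tri_coef_left_bound.
        -- apply tri_coef_right_bound.
    + apply Req_le.
      replace (sum_n (fun k => (a * c (S k) + b * c k)%R) n)
        with (a * sum_n (fun k => c (S k)) n + b * sum_n c n)%R.
      * match goal with |- @eq _ ?x ?y => change (@eq R x y) end; change plus with Rplus; ring.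
      * rewrite <- (sum_n_mult_l (K := R_Ring) a (fun k => c (S k))).
        rewrite <- (sum_n_mult_l (K := R_Ring) b c).
        symmetry; exact (sum_n_plus (G := R_AbelianMonoid)
          (fun k => a * c (S k))%R (fun k => b * c k)%R n).
  - rewrite sum_Sn; change plus with Rplus.
    (* Row [n] ends at [k = n], so both sums are [rownorm g0 ginf n]. *)
    replace (c (S n)) with 0%R
      by (unfold c; rewrite gkp_above by lia; symmetry; apply Cmod_0).
    change (sum_n c n) with (rownorm g0 ginf n); unfold a, b.
    assert (H := pos_INR n); nra.
Qed.

(** Since [4 n + |g0| + |ginf| <= M (n + 1)], each step multiplies the bound by [M (n + 1)]. *)
Lemma rownorm_bound g0 ginf M n :
  (4 + Cmod g0 + Cmod ginf <= M)%R ->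
  (rownorm g0 ginf n <= M ^ n * INR (Factorial.fact n))%R.
Proof.
  intros HM; assert (H0 := Cmod_ge_0 g0); assert (H1 := Cmod_ge_0 ginf).
  induction n as [|n IH].
  - unfold rownorm; rewrite sum_O; simpl; rewrite Cmod_1; lra.
  - eapply Rle_trans; [apply rownorm_S|].
    assert (Hn := pos_INR n).
    apply Rle_trans with ((M * (INR n + 1)) * (M ^ n * INR (Factorial.fact n)))%R.
    + eapply Rle_trans; [apply Rmult_le_compat_l; [lra | apply IH]|].
      apply Rmult_le_compat_r; [|nra].
      apply Rmult_le_pos; [apply pow_le; lra | apply pos_INR].
    + change (Factorial.fact (S n)) with (S n * Factorial.fact n)%nat.
      rewrite mult_INR, S_INR; simpl; apply Req_le; ring.
Qed.

Lemma Cmod_csum f n : (Cmod (csum f n) <= sum_n (fun k => Cmod (f k)) n)%R.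
Proof.
  induction n as [|n IH].
  - rewrite csum_O, sum_O; lra.
  - rewrite csum_S, sum_Sn; eapply Rle_trans; [apply Cmod_triangle|].
    now apply Rplus_le_compat_r.
Qed.

Lemma Cmod_factC n : Cmod (factC n) = INR (Factorial.fact n).
Proof. unfold factC; rewrite Cmod_R; apply Rabs_pos_eq, pos_INR. Qed.

Lemma pow_le_1 r n : (0 <= r <= 1)%R -> (r ^ n <= 1)%R.
Proof. intros H; rewrite <- (pow1 n); now apply pow_incr. Qed.

Definition tcoef (g0 ginf : C) (n k : nat) : C := tri g0 ginf n k / factC n.

Lemma tcoef_above g0 ginf n k : (n < k)%nat -> tcoef g0 ginf n k = 0.
Proof. intros H; unfold tcoef, Cdiv; rewrite gkp_above by easy; cring. Qed.

(** The [n!] of the row bound cancels the denominator of [tcoef], and [r^k <= 1] makes the bound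
    uniform in [r]. *)
Lemma sum_tcoef_bound g0 ginf M r s n :
  (4 + Cmod g0 + Cmod ginf <= M)%R -> (0 <= r <= 1)%R -> (0 <= s)%R ->
  (sum_n (fun k => Cmod (tcoef g0 ginf n k) * r ^ k * s ^ n) n <= (M * s) ^ n)%R.
Proof.
  intros HM Hr Hs.
  assert (Hf := INR_fact_lt_0 n).
  apply Rle_trans with
    (sum_n (fun k => (s ^ n / INR (Factorial.fact n)) * Cmod (tri g0 ginf n k))%R n).
  - apply sum_n_m_le; intros k; unfold tcoef.
    rewrite Cmod_div, Cmod_factC by apply factC_neq_0.
    replace (s ^ n / INR (Factorial.fact n) * Cmod (tri g0 ginf n k))%R
      with (Cmod (tri g0 ginf n k) / INR (Factorial.fact n) * 1 * s ^ n)%R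
      by (field; lra).
    apply Rmult_le_compat_r; [now apply pow_le|].
    apply Rmult_le_compat_l; [|now apply pow_le_1].
    apply Rdiv_le_0_compat; [apply Cmod_ge_0 | easy].
  - eapply Rle_trans; [apply Req_le, (sum_n_mult_l (K := R_Ring))|].
    change (s ^ n / INR (Factorial.fact n) * rownorm g0 ginf n <= (M * s) ^ n)%R.
    eapply Rle_trans; [apply Rmult_le_compat_l, rownorm_bound, HM|].
    + apply Rdiv_le_0_compat; [now apply pow_le | easy].
    + rewrite Rpow_mult_distr; apply Req_le; field; lra.
Qed.

Lemma egf_tcoef g0 ginf n t z :
  egf g0 ginf n t * Cpow z n =
  csum (fun k => tcoef g0 ginf n k * Cpow t k * Cpow z n) n.
Proof.
  unfold egf, row, tcoef.
  transitivity (Cpow z n / factC n * csum (fun k => tri g0 ginf n k * Cpow t k) n).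
  - unfold Cdiv; cring.
  - rewrite <- csum_mult_l; apply csum_ext; intros k _; unfold Cdiv; cring.
Qed.

Lemma egf_bound g0 ginf M t z n :
  (4 + Cmod g0 + Cmod ginf <= M)%R -> (Cmod t <= 1)%R ->
  (Cmod (egf g0 ginf n t * Cpow z n) <= (M * Cmod z) ^ n)%R.
Proof.
  intros HM Ht; rewrite egf_tcoef.
  eapply Rle_trans; [apply Cmod_csum|].
  eapply Rle_trans; [|apply (sum_tcoef_bound g0 ginf M (Cmod t) (Cmod z));
    [easy | split; [apply Cmod_ge_0 | easy] | apply Cmod_ge_0]].
  apply sum_n_m_le; intros k; rewrite !Cmod_mult, !Cmod_pow; lra.
Qed.

(** For [|t| <= 1/2] both [|1/2 - t|] and [|t (1 - t)|] are at most [1], hence so is every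
    [|acoef n t|]. *)
Lemma acf_bound t z n :
  (Cmod t <= 1/2)%R -> (Cmod (acf n t * Cpow z n) <= Cmod z ^ n)%R.
Proof.
  intros Ht.
  assert (Ha : forall n, (Cmod (acoef n t) <= 1)%R).
  { assert (H1 : forall c : C, (Cmod c <= 1 -> Cmod (c - t) <= Cmod c + 1/2)%R).
    { intros c Hc; eapply Rle_trans; [apply Cmod_triangle|]; rewrite Cmod_opp; lra. }
    assert (Hu : (Cmod (- (t * (1 - t))) <= 1)%R).
    { rewrite Cmod_opp, Cmod_mult.
      assert (H := H1 1); rewrite Cmod_1 in H.
      assert (H2 := Cmod_ge_0 t); assert (H3 := Cmod_ge_0 (1 - t)); nra. }
    apply nat_ind2.
    - simpl; rewrite Cmod_1; lra.
    - simpl; eapply Rle_trans; [apply H1|]; rewrite Cmod_half; lra.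
    - intros m IH _; change (Cmod (- (t * (1 - t)) * acoef m t) <= 1)%R.
      rewrite Cmod_mult; assert (H2 := Cmod_ge_0 (acoef m t)); 
        assert (H3 := Cmod_ge_0 (- (t * (1 - t)))); nra. }
  rewrite Cmod_mult, Cmod_pow; rewrite <- (Rmult_1_l (Cmod z ^ n)) at 2.
  apply Rmult_le_compat_r; [apply pow_le, Cmod_ge_0|].
  unfold acf; rewrite Cmod_div, Cmod_factC by apply factC_neq_0.
  assert (Hf : (1 <= INR (Factorial.fact n))%R)
    by (apply (le_INR 1), Factorial.lt_O_fact).
  apply (Rmult_le_reg_r (INR (Factorial.fact n))); [lra|].
  replace (Cmod (acoef n t) / INR (Factorial.fact n) * INR (Factorial.fact n))%R
    with (Cmod (acoef n t)) by (field; lra).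
  rewrite Rmult_1_l; eapply Rle_trans; [apply Ha | easy].
Qed.

Lemma is_series_finite {K : AbsRing} {V : NormedModule K} (f : nat -> V) n :
  (forall k, (n < k)%nat -> f k = zero) -> is_series f (sum_n f n).
Proof.
  intros H; apply filterlim_ext_loc with (f := fun _ => sum_n f n).
  - exists n; intros N HN; induction HN as [|N HN IH]; [easy|].
    rewrite sum_Sn, <- IH, H by lia; now rewrite plus_zero_r.
  - apply filterlim_const.
Qed.

(** * Complex-valued functions of a real variable *)

Definition reS (x : nat -> C) (n : nat) : R := Re (x n).
Definition imS (x : nat -> C) (n : nat) : R := Im (x n).
Definition cps (x : nat -> C) (s : R) : C := (PSeries (reS x) s, PSeries (imS x) s).
(** The inequalities are strict, as termwise differentiation and Cauchy products require. *)
Definition in_disk (x : nat -> C) (s : R) : Prop :=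
  Rbar_lt (Rabs s) (CV_radius (reS x)) /\ Rbar_lt (Rabs s) (CV_radius (imS x)).

Lemma im_le_Cmod (c : C) : (Rabs (Im c) <= Cmod c)%R.
Proof. eapply Rle_trans; [apply Rmax_r | apply (Rmax_Cmod c)]. Qed.

(** Decay of ratio [1/4] gives radius at least [4], so the whole segment, its end point [1]
    included, lies strictly inside. *)
Lemma CV_radius_geom (a : nat -> R) K s :
  (forall n, Rabs (a n) <= K * (1/4) ^ n)%R -> (Rabs s <= 1)%R ->
  Rbar_lt (Rabs s) (CV_radius a).
Proof.
  intros Ha Hs; apply Rbar_lt_le_trans with 4%R; [simpl; lra|].
  apply (CV_radius_bounded a); exists K; intros n.
  rewrite Rabs_mult, <- RPow_abs, (Rabs_pos_eq 4) by lra.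
  replace K with ((K * (1/4) ^ n) * 4 ^ n)%R.
  - apply Rmult_le_compat_r; [apply pow_le; lra | apply Ha].
  - rewrite Rmult_assoc, <- Rpow_mult_distr.
    replace (1/4 * 4)%R with 1%R by field; rewrite pow1; ring.
Qed.

Lemma in_disk_geom x K s :
  (forall n, Cmod (x n) <= K * (1/4) ^ n)%R -> (Rabs s <= 1)%R -> in_disk x s.
Proof.
  intros Hx Hs; split; apply (CV_radius_geom _ K); try easy; intros n;
    (eapply Rle_trans; [|apply Hx]); [apply re_le_Cmod | apply im_le_Cmod].
Qed.

Lemma cps_ext x y s : (forall n, x n = y n) -> cps x s = cps y s.
Proof.
  intros H; unfold cps; f_equal; apply PSeries_ext; intros n;
    unfold reS, imS; now rewrite H.
Qed.

Lemma cps_0 x : cps x 0 = x 0%nat.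
Proof. unfold cps; rewrite !PSeries_0; unfold reS, imS; now destruct (x 0%nat). Qed.

Lemma C_eq (a b : C) : Re a = Re b -> Im a = Im b -> a = b.
Proof. destruct a, b; simpl; congruence. Qed.

(** Weaker than [in_disk], but enough for linear combinations; [pconv_conv] provides it for Cauchy
    products. *)
Definition pconv (x : nat -> C) (s : R) : Prop :=
  ex_pseries (reS x) s /\ ex_pseries (imS x) s.

Lemma in_disk_pconv x s : in_disk x s -> pconv x s.
Proof. intros [H H']; split; now apply CV_radius_inside. Qed.

Lemma cps_plus x y s :
  pconv x s -> pconv y s -> cps (fun n => x n + y n) s = cps x s + cps y s.
Proof.
  intros [Hx Hx'] [Hy Hy']; apply C_eq; simpl;
    rewrite <- PSeries_plus by easy; now apply PSeries_ext.
Qed.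

Lemma ex_pseries_scal_R (r : R) (a : nat -> R) s :
  ex_pseries a s -> ex_pseries (PS_scal r a) s.
Proof. apply ex_pseries_scal, Rmult_comm. Qed.

Lemma pconv_scal c x s : pconv x s -> pconv (fun n => c * x n) s.
Proof.
  intros [Hx Hx']; split.
  - apply (ex_pseries_ext (PS_minus (PS_scal (Re c) (reS x)) (PS_scal (Im c) (imS x))));
      [easy | apply ex_pseries_minus; now apply ex_pseries_scal_R].
  - apply (ex_pseries_ext (PS_plus (PS_scal (Re c) (imS x)) (PS_scal (Im c) (reS x))));
      [easy | apply ex_pseries_plus; now apply ex_pseries_scal_R].
Qed.

Lemma cps_scal c x s : pconv x s -> cps (fun n => c * x n) s = c * cps x s.
Proof.
  intros [Hx Hx']; apply C_eq; simpl;
    change (fst c) with (Re c); change (snd c) with (Im c); rewrite <- !PSeries_scal.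
  - rewrite <- PSeries_minus by now apply ex_pseries_scal_R.
    now apply PSeries_ext.
  - rewrite <- PSeries_plus by now apply ex_pseries_scal_R.
    now apply PSeries_ext.
Qed.

Lemma Re_csum f n : Re (csum f n) = sum_f_R0 (fun k => Re (f k)) n.
Proof.
  induction n as [|n IH]; [now rewrite csum_O|].
  rewrite csum_S, re_plus, IH; reflexivity.
Qed.

Lemma Im_csum f n : Im (csum f n) = sum_f_R0 (fun k => Im (f k)) n.
Proof.
  induction n as [|n IH]; [now rewrite csum_O|].
  rewrite csum_S, im_plus, IH; reflexivity.
Qed.

Lemma reS_conv x y n :
  PS_minus (PS_mult (reS x) (reS y)) (PS_mult (imS x) (imS y)) n = reS (conv x y) n.
Proof.
  unfold reS at 3, conv; rewrite Re_csum.
  unfold PS_minus, PS_opp, PS_plus, PS_mult.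
  change (plus ?a (opp ?b)) with (a - b)%R.
  rewrite <- minus_sum; now apply sum_eq.
Qed.

Lemma imS_conv x y n :
  PS_plus (PS_mult (reS x) (imS y)) (PS_mult (imS x) (reS y)) n = imS (conv x y) n.
Proof.
  unfold imS at 3, conv; rewrite Im_csum.
  unfold PS_plus, PS_mult; change (plus ?a ?b) with (a + b)%R.
  rewrite <- plus_sum; now apply sum_eq.
Qed.

Lemma pconv_conv x y s : in_disk x s -> in_disk y s -> pconv (conv x y) s.
Proof.
  intros [Hx Hx'] [Hy Hy']; split.
  - apply (ex_pseries_ext _ _ s (reS_conv x y)).
    apply ex_pseries_minus; now apply ex_pseries_mult.
  - apply (ex_pseries_ext _ _ s (imS_conv x y)).
    apply ex_pseries_plus; now apply ex_pseries_mult.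
Qed.

Lemma cps_conv x y s :
  in_disk x s -> in_disk y s -> cps (conv x y) s = cps x s * cps y s.
Proof.
  intros [Hx Hx'] [Hy Hy']; apply C_eq; simpl; rewrite <- !PSeries_mult by easy.
  - rewrite <- PSeries_minus by now apply ex_pseries_mult.
    symmetry; apply PSeries_ext, reS_conv.
  - rewrite <- PSeries_plus by now apply ex_pseries_mult.
    symmetry; apply PSeries_ext, imS_conv.
Qed.

Definition cder (x : nat -> C) (n : nat) : C := nC (S n) * x (S n).

Lemma reS_cder x n : reS (cder x) n = PS_derive (reS x) n.
Proof. apply re_scal_l. Qed.

Lemma imS_cder x n : imS (cder x) n = PS_derive (imS x) n.
Proof. apply im_scal_l. Qed.

Lemma in_disk_cder x s : in_disk x s -> in_disk (cder x) s.
Proof.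
  intros [H H']; split.
  - now rewrite (CV_radius_ext _ _ (reS_cder x)), CV_radius_derive.
  - now rewrite (CV_radius_ext _ _ (imS_cder x)), CV_radius_derive.
Qed.

Definition rc_derive (f : R -> C) (s : R) (l : C) : Prop :=
  is_derive (fun r => Re (f r)) s (Re l) /\ is_derive (fun r => Im (f r)) s (Im l).

Lemma rc_derive_eq f s l l' : l = l' -> rc_derive f s l -> rc_derive f s l'.
Proof. now intros <-. Qed.

Lemma rc_derive_cps x s : in_disk x s -> rc_derive (cps x) s (cps (cder x) s).
Proof.
  intros [H H']; split; simpl.
  - rewrite (PSeries_ext _ _ s (reS_cder x)); now apply is_derive_PSeries.
  - rewrite (PSeries_ext _ _ s (imS_cder x)); now apply is_derive_PSeries.
Qed.

Lemma rc_derive_const c s : rc_derive (fun _ => c) s 0.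
Proof. split; apply (is_derive_const (V := R_NormedModule)). Qed.

Lemma rc_derive_id s : rc_derive (fun r => RtoC r) s 1.
Proof. split; simpl; auto_derive; easy. Qed.

Lemma rc_derive_plus f g s df dg :
  rc_derive f s df -> rc_derive g s dg ->
  rc_derive (fun r => f r + g r) s (df + dg).
Proof.
  intros [F F'] [G G']; split.
  - exact (is_derive_plus _ _ _ _ _ F G).
  - exact (is_derive_plus _ _ _ _ _ F' G').
Qed.

Lemma is_derive_eq_ext (f g : R -> R) s (df dg : R) :
  (forall r, f r = g r) -> df = dg -> is_derive f s df -> is_derive g s dg.
Proof. intros Hfg <-; now apply is_derive_ext. Qed.

Lemma is_derive_Rmult (f g : R -> R) s df dg :
  is_derive f s df -> is_derive g s dg ->
  is_derive (fun r => f r * g r)%R s (df * g s + f s * dg)%R.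
Proof.
  intros Hf Hg; exact (is_derive_mult f g s df dg Hf Hg Rmult_comm).
Qed.

Lemma rc_derive_mult f g s df dg :
  rc_derive f s df -> rc_derive g s dg ->
  rc_derive (fun r => f r * g r) s (df * g s + f s * dg).
Proof.
  intros [F F'] [G G']; split.
  - generalize (is_derive_minus _ _ _ _ _ (is_derive_Rmult _ _ _ _ _ F G)
      (is_derive_Rmult _ _ _ _ _ F' G')).
    apply is_derive_eq_ext; [now intros|].
    unfold minus, plus, opp; simpl; unfold Re, Im; ring.
  - generalize (is_derive_plus _ _ _ _ _ (is_derive_Rmult _ _ _ _ _ F G')
      (is_derive_Rmult _ _ _ _ _ F' G)).
    apply is_derive_eq_ext; [now intros|].
    unfold plus; simpl; unfold Re, Im; ring.
Qed.

Lemma rc_derive_scal c f s df :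
  rc_derive f s df -> rc_derive (fun r => c * f r) s (c * df).
Proof.
  intros Hf; eapply rc_derive_eq;
    [|exact (rc_derive_mult _ _ _ _ _ (rc_derive_const c s) Hf)].
  simpl; cring.
Qed.

Lemma rc_derive_cexp f s df :
  rc_derive f s df -> rc_derive (fun r => cexp (f r)) s (cexp (f s) * df).
Proof.
  intros [F F'].
  assert (E := is_derive_comp exp _ s _ _ (is_derive_exp _) F).
  assert (Co := is_derive_comp cos _ s _ _ (is_derive_cos _) F').
  assert (Si := is_derive_comp sin _ s _ _ (is_derive_sin _) F').
  split.
  - generalize (is_derive_Rmult _ _ _ _ _ E Co).
    apply is_derive_eq_ext; [now intros|].
    unfold scal, mult; simpl; unfold mult; simpl; unfold Re, Im; ring.
  - generalize (is_derive_Rmult _ _ _ _ _ E Si).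
    apply is_derive_eq_ext; [now intros|].
    unfold scal, mult; simpl; unfold mult; simpl; unfold Re, Im; ring.
Qed.

Lemma ln_sqrt_half x : (0 < x)%R -> ln (sqrt x) = (1/2 * ln x)%R.
Proof.
  intros Hx; assert (Hs := sqrt_lt_R0 _ Hx).
  rewrite <- (sqrt_sqrt x) at 2 by lra; rewrite ln_mult by easy; lra.
Qed.

(** In the right half-plane the principal logarithm is [1/2 ln (x^2 + y^2) + i atan (y / x)], and
    the chain rule applies to each component. *)
Lemma rc_derive_Clog f s df :
  (0 < Re (f s))%R -> rc_derive f s df ->
  rc_derive (fun r => Clog (f r)) s (df / f s).
Proof.
  intros Hpos [F F'].
  assert (Hn : (0 < Re (f s) * Re (f s) + Im (f s) * Im (f s))%R) by nra.
  assert (Hcont : continuous (fun r => Re (f r)) s)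
    by (apply (ex_derive_continuous (V := R_NormedModule)); eexists; exact F).
  (* The branch of [Arg] must be the same in a whole neighbourhood of [s]; continuity of the real
     part ensures it. *)
  assert (Hloc : locally s (fun r => 0 < Re (f r))%R)
    by exact (Hcont _ (open_gt 0%R _ Hpos)).
  split.
  - assert (N := is_derive_plus _ _ _ _ _ (is_derive_Rmult _ _ _ _ _ F F)
      (is_derive_Rmult _ _ _ _ _ F' F')).
    generalize (is_derive_scal _ _ (1/2) _
      (is_derive_comp ln _ s _ _ (is_derive_ln _ Hn) N)).
    intros H; refine (is_derive_ext_loc _ _ _ _ _ (is_derive_eq_ext _ _ _ _ _
      (fun r => eq_refl) _ H)).
    + revert Hloc; apply filter_imp; intros r Hr; simpl.
      unfold Cmod; rewrite ln_sqrt_half.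
      * change plus with Rplus; unfold Re, Im; simpl; rewrite !Rmult_1_r; field.
      * unfold Re in Hr; simpl; nra.
    + unfold scal, mult, plus; simpl; unfold mult; simpl.
      unfold Re, Im in *; field; lra.
  - assert (Hne : Re (f s) <> 0%R) by lra.
    assert (Q := is_derive_div _ _ _ _ _ F' F Hne).
    generalize (is_derive_comp atan _ s _ _ (is_derive_atan _) Q).
    intros H; refine (is_derive_ext_loc _ _ _ _ _ (is_derive_eq_ext _ _ _ _ _
      (fun r => eq_refl) _ H)).
    + revert Hloc; apply filter_imp; intros r Hr; simpl; unfold Arg.
      now destruct (Rlt_dec 0 (Re (f r))).
    + unfold scal, mult, Rsqr; simpl; unfold mult; simpl.
      unfold Re, Im in *; field; repeat split; nra.
Qed.

(** Serves for conserved quantities: an expression whose derivative vanishes on the segment is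
    evaluated at [s = 0]. *)
Lemma rc_derive_0_const f :
  (forall s, (0 <= s <= 1)%R -> rc_derive f s 0) ->
  forall s, (0 <= s <= 1)%R -> f s = f 0%R.
Proof.
  intros H s Hs; destruct (Rle_lt_or_eq_dec 0 s (proj1 Hs)) as [Hs'|<-]; [|easy].
  apply C_eq; symmetry.
  - apply (eq_is_derive (fun r => Re (f r)) 0 s); [|easy].
    intros r Hr; apply (H r); lra.
  - apply (eq_is_derive (fun r => Im (f r)) 0 s); [|easy].
    intros r Hr; apply (H r); lra.
Qed.

(** The terms after the constant [1] contribute at most [1/4 + 1/16 + ... = 1/3]. This keeps [q_+]
    and [q_-] in the half-plane where [Clog] is differentiable. *)
Lemma Re_cps_pos x s :
  (forall n, Cmod (x n) <= (1/4) ^ n)%R -> x 0%nat = 1 -> (0 <= s <= 1)%R ->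
  (0 < Re (cps x s))%R.
Proof.
  intros Hx H0 Hs; simpl.
  assert (Hd : in_disk x s).
  { apply (in_disk_geom x 1); [intros n; rewrite Rmult_1_l; apply Hx|].
    rewrite Rabs_pos_eq; lra. }
  rewrite PSeries_decr_1 by apply CV_radius_inside, Hd.
  unfold reS at 1; rewrite H0; change (Re 1) with 1%R.
  set (y := PS_decr_1 (reS x)).
  assert (Hy : forall n, (Rabs (y n * s ^ n) <= 1/4 * (1/4) ^ n)%R).
  { intros n; rewrite Rabs_mult, (Rabs_pos_eq (s ^ n)) by (apply pow_le; lra).
    rewrite <- (Rmult_1_r (1/4 * (1/4) ^ n)).
    apply Rmult_le_compat; [apply Rabs_pos | apply pow_le; lra | | now apply pow_le_1].
    eapply Rle_trans; [apply re_le_Cmod | apply (Hx (S n))]. }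
  assert (Hg : (Rabs (1/4) < 1)%R) by (rewrite Rabs_pos_eq; lra).
  assert (Hex : ex_series (fun n => 1/4 * (1/4) ^ n)%R)
    by exact (ex_series_scal_l (1/4)%R _ (ex_series_geom _ Hg)).
  assert (B : (Rabs (PSeries y s) <= 1/3)%R).
  { eapply Rle_trans; [apply Series_Rabs|].
    - apply (ex_series_le (V := R_CompleteNormedModule) _ _) with (2 := Hex).
      intros n; unfold norm; simpl; unfold abs; simpl; rewrite Rabs_Rabsolu; apply Hy.
    - eapply Rle_trans; [apply Series_le with (2 := Hex)|].
      + intros n; split; [apply Rabs_pos | apply Hy].
      + rewrite Series_scal_l, Series_geom by easy; lra. }
  apply Rabs_le_between in B; nra.
Qed.

Lemma is_series_C (x : nat -> C) (a b : R) :
  is_series (reS x) a -> is_series (imS x) b ->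
  @is_series C_AbsRing C_NormedModule x ((a, b) : C).
Proof.
  intros Ha Hb; apply filterlim_locally; intros eps.
  assert (Ha' := proj1 (filterlim_locally _ _) Ha eps).
  assert (Hb' := proj1 (filterlim_locally _ _) Hb eps).
  generalize (filter_and _ _ Ha' Hb'); apply filter_imp; intros n [H1 H2].
  split.
  - change (ball a eps (Re (csum x n))).
    rewrite Re_csum, <- sum_n_Reals; exact H1.
  - change (ball b eps (Im (csum x n))).
    rewrite Im_csum, <- sum_n_Reals; exact H2.
Qed.

(** At the end point [s = 1] the powers of [s] disappear, leaving the sum of the series itself. *)
Lemma is_series_cps x :
  in_disk x 1 -> @is_series C_AbsRing C_NormedModule x (cps x 1).
Proof.
  assert (H : forall a : nat -> R, Rbar_lt (Rabs 1) (CV_radius a) ->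
    is_series a (PSeries a 1)).
  { intros a Ha; apply (is_series_ext (fun n => a n * 1 ^ n)%R).
    - intros n; rewrite pow1; apply Rmult_1_r.
    - apply Series_correct.
      generalize (CV_radius_inside _ _ Ha); apply ex_series_ext; intros n.
      rewrite pow_n_pow; apply Rmult_comm. }
  intros [H1 H2]; apply is_series_C; now apply H.
Qed.

(** * Principal branches *)

Lemma cexp_plus a b : cexp (a + b) = cexp a * cexp b.
Proof.
  unfold cexp; rewrite re_plus, im_plus, exp_plus, cos_plus, sin_plus.
  apply C_eq; simpl; ring.
Qed.

Lemma cexp_0 : cexp 0 = 1.
Proof. unfold cexp; simpl; rewrite exp_0, cos_0, sin_0; apply C_eq; simpl; ring. Qed.

Lemma cexp_opp_r a : cexp a * cexp (- a) = 1.
Proof. rewrite <- cexp_plus, Cplus_opp_r; apply cexp_0. Qed.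

Lemma Cmod_sqr (z : C) : (Cmod z * Cmod z = Re z * Re z + Im z * Im z)%R.
Proof.
  unfold Cmod; rewrite sqrt_sqrt; unfold Re, Im; simpl; [ring|nra].
Qed.

(** The radical that [cos_atan] and [sin_atan] produce in polar coordinates. *)
Lemma sqrt_1_div_sqr (z : C) :
  Re z <> 0%R -> sqrt (1 + (Im z / Re z)²) = (Cmod z / Rabs (Re z))%R.
Proof.
  intros Hx.
  assert (Ha : (0 < Rabs (Re z))%R) by now apply Rabs_pos_lt.
  assert (Hq : (Rabs (Re z) * Rabs (Re z) = Re z * Re z)%R)
    by (rewrite <- Rabs_mult, Rabs_pos_eq; [easy|nra]).
  apply sqrt_lem_1.
  - unfold Rsqr; nra.
  - apply Rdiv_le_0_compat; [apply Cmod_ge_0 | easy].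
  - replace (Cmod z / Rabs (Re z) * (Cmod z / Rabs (Re z)))%R
      with ((Cmod z * Cmod z) / (Rabs (Re z) * Rabs (Re z)))%R by (field; lra).
    rewrite Cmod_sqr, Hq; unfold Rsqr; field; easy.
Qed.

Lemma cexp_Clog (z : C) : z <> 0 -> cexp (Clog z) = z.
Proof.
  intros Hz; assert (Hm := proj1 (Cmod_gt_0 z) Hz).
  unfold cexp, Clog; simpl; rewrite exp_ln by easy.
  enough (H : (Cmod z * cos (Arg z) = Re z /\ Cmod z * sin (Arg z) = Im z)%R)
    by (destruct H as [-> ->]; now destruct z).
  unfold Arg.
  assert (Hat : Re z <> 0%R ->
    (Cmod z * cos (atan (Im z / Re z)) = Rabs (Re z) /\
     Cmod z * sin (atan (Im z / Re z)) = Rabs (Re z) * (Im z / Re z))%R).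
  { intros Hx; rewrite cos_atan, sin_atan, sqrt_1_div_sqr by easy.
    assert (Ha : Rabs (Re z) <> 0%R) by now apply Rabs_no_R0.
    split; field; repeat split; lra. }
  destruct (Rlt_dec 0 (Re z)) as [Hx|Hx].
  { destruct Hat as [-> ->]; [lra|]; rewrite Rabs_pos_eq by lra; split; [easy|].
    field; lra. }
  destruct (Rlt_dec (Re z) 0) as [Hx'|Hx'].
  (* A shift by [PI] or [- PI] negates both cosine and sine, which settles the two left quadrants at
     once. *)
  { assert (Hc : forall e : R, e = PI \/ e = (- PI)%R ->
      (Cmod z * cos (atan (Im z / Re z) + e) = Re z /\
       Cmod z * sin (atan (Im z / Re z) + e) = Im z)%R).
    { intros e He.
      assert (He1 : cos e = (-1)%R /\ sin e = 0%R).
      { destruct He as [-> | ->].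
        - split; [apply cos_PI | apply sin_PI].
        - rewrite cos_neg, sin_neg, cos_PI, sin_PI; split; lra. }
      destruct He1 as [E1 E2]; rewrite cos_plus, sin_plus, E1, E2.
      destruct Hat as [C1 S1]; [lra|]; rewrite Rabs_left in C1, S1 by easy.
      split.
      - transitivity (- (Cmod z * cos (atan (Im z / Re z))))%R; [ring|].
        rewrite C1; ring.
      - transitivity (- (Cmod z * sin (atan (Im z / Re z))))%R; [ring|].
        rewrite S1; field; lra. }
    destruct (Rle_dec 0 (Im z)); [|unfold Rminus]; apply Hc; auto. }
  assert (H0 : Re z = 0%R) by lra.
  assert (Hs := Cmod_sqr z); rewrite H0 in Hs.
  destruct (Rlt_dec 0 (Im z)).
  { rewrite cos_PI2, sin_PI2; split; [lra|]; nra. }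
  destruct (Rlt_dec (Im z) 0).
  { rewrite cos_neg, sin_neg, cos_PI2, sin_PI2; split; [lra|]; nra. }
  exfalso; nra.
Qed.

Lemma csqrt_sqr z : csqrt z * csqrt z = z.
Proof.
  unfold csqrt; destruct (Ceq_dec z 0) as [->|Hz]; [cring|].
  rewrite <- cexp_plus; replace (Clog z / 2 + Clog z / 2) with (Clog z) by field.
  now apply cexp_Clog.
Qed.

Lemma Arg_range (z : C) :
  (- PI < Arg z <= PI)%R /\ (0 < Im z -> 0 < Arg z < PI)%R /\
  (Im z < 0 -> - PI < Arg z < 0)%R.
Proof.
  assert (Hpi := PI_RGT_0); unfold Arg.
  assert (Hb := atan_bound (Im z / Re z)).
  assert (Hpos : (0 < Im z / Re z -> 0 < atan (Im z / Re z))%R)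
    by (intros H; rewrite <- atan_0; now apply atan_increasing).
  assert (Hneg : (Im z / Re z < 0 -> atan (Im z / Re z) < 0)%R)
    by (intros H; rewrite <- atan_0; now apply atan_increasing).
  assert (Hzero : (Im z = 0 -> atan (Im z / Re z) = 0)%R)
    by (intros ->; unfold Rdiv; rewrite Rmult_0_l; apply atan_0).
  destruct (Rlt_dec 0 (Re z)) as [Hx|Hx].
  { assert (Hi := Rinv_0_lt_compat _ Hx).
    split; [lra|]; split; intros Hy; split; try lra.
    - apply Hpos; unfold Rdiv; nra.
    - apply Hneg; unfold Rdiv; nra. }
  destruct (Rlt_dec (Re z) 0) as [Hx'|Hx'].
  { assert (Hi := Rinv_lt_0_compat _ Hx').
    destruct (Rle_dec 0 (Im z)) as [Hy|Hy].
    - assert (Hle : (atan (Im z / Re z) <= 0)%R).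
      { destruct Hy as [Hy|Hy]; [apply Rlt_le, Hneg; unfold Rdiv; nra|].
        rewrite Hzero; lra. }
      split; [lra|]; split; intros Hy'; [|lra].
      assert (atan (Im z / Re z) < 0)%R by (apply Hneg; unfold Rdiv; nra); lra.
    - assert (0 < atan (Im z / Re z))%R by (apply Hpos; unfold Rdiv; nra).
      split; [lra|]; split; intros; lra. }
  destruct (Rlt_dec 0 (Im z)); [lra|]; destruct (Rlt_dec (Im z) 0); lra.
Qed.

(** [cos a = 1 - 2 sin^2 (a/2)], and the sine has no zero strictly between [0] and [PI]. *)
Lemma cos_eq_1_range a : (- (2 * PI) < a < 2 * PI)%R -> cos a = 1%R -> a = 0%R.
Proof.
  intros Ha Hc.
  assert (Hs : sin (a / 2) = 0%R).
  { replace a with (2 * (a / 2))%R in Hc by field.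
    rewrite cos_2a_sin in Hc; nra. }
  destruct (Rtotal_order a 0) as [H|[H|H]]; [|easy|].
  - assert (0 < sin (- (a / 2)))%R by (apply sin_gt_0; lra).
    rewrite sin_neg in H0; lra.
  - assert (0 < sin (a / 2))%R by (apply sin_gt_0; lra); lra.
Qed.

(** Two arguments in [(-PI, PI]] differ by less than [2 PI], and here the cosine of their difference
    is [1]. *)
Lemma Arg_unique (z : C) (th : R) :
  z <> 0 -> (- PI < th <= PI)%R -> cexp (ln (Cmod z), th) = z -> Arg z = th.
Proof.
  intros Hz Hth E; assert (Hm := proj1 (Cmod_gt_0 z) Hz).
  assert (E' := cexp_Clog z Hz); rewrite <- E in E' at 2.
  unfold cexp, Clog in E'; simpl in E'; rewrite exp_ln in E' by easy.
  injection E' as Ec Es.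
  apply Rmult_eq_reg_l in Ec; [|lra]; apply Rmult_eq_reg_l in Es; [|lra].
  destruct (Arg_range z) as [Hr _].
  enough (Arg z - th = 0)%R by lra.
  apply cos_eq_1_range; [lra|].
  rewrite cos_minus, Ec, Es; generalize (sin2_cos2 th); unfold Rsqr; lra.
Qed.

(** The imaginary parts of [t] and [1 - t] are opposite, so their arguments have opposite signs and
    the sum stays in [(-PI, PI]]. For real [t] the argument of [1 - t > 0] is zero. *)
Lemma csqrt_mult_1_minus (t : C) :
  (Re t < 1)%R -> csqrt t * csqrt (1 - t) = csqrt (t * (1 - t)).
Proof.
  intros Ht; destruct (Ceq_dec t 0) as [->|Ht0].
  - rewrite Cmult_0_l; unfold csqrt; destruct (Ceq_dec 0 0); [cring | easy].
  - assert (H1 : 1 - t <> 0).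
    { intros H; apply (f_equal Re) in H; simpl in H; unfold Re in Ht; lra. }
    assert (H2 := Cmult_neq_0 _ _ Ht0 H1).
    unfold csqrt.
    destruct (Ceq_dec t 0) as [|_]; [easy|].
    destruct (Ceq_dec (1 - t) 0) as [|_]; [easy|].
    destruct (Ceq_dec (t * (1 - t)) 0) as [|_]; [easy|].
    rewrite <- cexp_plus; f_equal.
    replace (Clog (t * (1 - t))) with (Clog t + Clog (1 - t)); [field|].
    assert (Hln : ln (Cmod (t * (1 - t))) = (ln (Cmod t) + ln (Cmod (1 - t)))%R)
      by (rewrite Cmod_mult; apply ln_mult; now apply (proj1 (Cmod_gt_0 _))).
    symmetry; unfold Clog; rewrite Hln; apply C_eq; [easy|].
    change (Arg (t * (1 - t)) = Arg t + Arg (1 - t))%R.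
    apply Arg_unique; [easy| |].
    + destruct (Arg_range t) as [R1 [R2 R3]].
      destruct (Arg_range (1 - t)) as [_ [S2 S3]].
      assert (HI : Im (1 - t) = (- Im t)%R) by (simpl; unfold Im; ring).
      assert (HR : (0 < Re (1 - t))%R) by (simpl; unfold Re in Ht; lra).
      rewrite HI in S2, S3.
      destruct (Rtotal_order (Im t) 0) as [H|[H|H]].
      * specialize (R3 H); specialize (S2 ltac:(lra)); lra.
      * assert (HA : Arg (1 - t) = 0%R).
        { unfold Arg; destruct (Rlt_dec 0 (Re (1 - t))); [|easy].
          rewrite HI, H, Ropp_0; unfold Rdiv; rewrite Rmult_0_l; apply atan_0. }
        rewrite HA; lra.
      * specialize (R2 H); specialize (S3 ltac:(lra)); lra.
    + rewrite Hln; transitivity (cexp (Clog t + Clog (1 - t))); [easy|].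
      now rewrite cexp_plus, !cexp_Clog.
Qed.

(** * Exponential form of [s_+] and [s_-] *)

Lemma Ci_sqr : Ci * Ci = -(1).
Proof. apply C_eq; simpl; ring. Qed.

Lemma Ci_neq_0 : Ci <> 0.
Proof. intros H; apply (f_equal Im) in H; simpl in H; lra. Qed.

(** With [1 / i = - i], identities for the sine become polynomial in [Ci] and reduce by [Ci_sqr]. *)
Lemma csin_alt w : csin w = - Ci * (cexp (Ci * w) - cexp (- (Ci * w))) / 2.
Proof.
  unfold csin.
  replace (- Ci) with (/ Ci); [field; apply Ci_neq_0|].
  transitivity (- (Ci * Ci) * / Ci); [rewrite Ci_sqr; cring|].
  field; apply Ci_neq_0.
Qed.

(** The cross terms of the two squares cancel, leaving [(t + (1 - t)) (cos^2 + sin^2)]. *)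
Lemma sp_sm_sum t z : sp t z + sm t z = 1.
Proof.
  unfold sp, sm.
  rewrite csin_alt; unfold ccos.
  assert (H1 := csqrt_sqr (tp t)); assert (H2 := csqrt_sqr (tm t)).
  assert (H3 := cexp_opp_r (Ci * wz t z)).
  revert H1 H2 H3.
  generalize (csqrt (tp t)) (csqrt (tm t)) (cexp (Ci * wz t z))
    (cexp (- (Ci * wz t z))); intros a b e e' H1 H2 H3.
  transitivity ((a * a + b * b) * ((e + e') * (e + e') + (Ci * Ci) * ((e - e') * (e - e'))) / 4).
  - simpl; field.
  - rewrite H1, H2, Ci_sqr; unfold tp, tm.
    transitivity (e * e'); [field | exact H3].
Qed.

(** Double-angle formula [s_+ = 1/2 - (1/2 - t) cos (z q) + q sin (z q)], in exponentials. The cross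
    term contains [csqrt t * csqrt (1 - t)], which is [q] because [Re t < 1]. *)
Lemma sp_alt (t z : C) :
  (Re t < 1)%R ->
  let q := csqrt (t * (1 - t)) in
  sp t z = 1/2 - ((1/2 - t + Ci * q) * cexp (Ci * (z * q))
                  + (1/2 - t - Ci * q) * cexp (- (Ci * (z * q)))) / 2.
Proof.
  intros Ht q; unfold sp; rewrite csin_alt; unfold ccos.
  assert (H1 := csqrt_sqr t); assert (H2 := csqrt_sqr (1 - t)).
  assert (H4 := csqrt_mult_1_minus t Ht).
  assert (H3 := cexp_opp_r (Ci * wz t z)).
  replace (Ci * (z * q)) with (Ci * wz t z + Ci * wz t z)
    by (unfold wz, tp, tm; fold q; field).
  replace (- (Ci * wz t z + Ci * wz t z))
    with (- (Ci * wz t z) + - (Ci * wz t z)) by cring.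
  rewrite !cexp_plus; unfold tp, tm in *; fold q in H4; revert H1 H2 H3 H4.
  generalize (csqrt t) (csqrt (1 - t)) (cexp (Ci * wz t z))
    (cexp (- (Ci * wz t z))); intros a b e e' H1 H2 H3 H4.
  transitivity (((a * a) * (e * e + 2 * (e * e') + e' * e')
    + (Ci * Ci) * (b * b) * (e * e - 2 * (e * e') + e' * e')
    - 2 * Ci * (a * b) * (e * e - e' * e')) / 4).
  - simpl; field.
  - rewrite H1, H2, H3, H4, Ci_sqr; field.
Qed.

(** * Integration along a segment *)

Lemma in_disk_one_coef s : (Rabs s <= 1)%R -> in_disk one_coef s.
Proof.
  apply (in_disk_geom _ 1); intros [|n]; simpl.
  - rewrite Cmod_1; lra.
  - rewrite Cmod_0; assert (0 <= (1/4) ^ n)%R by (apply pow_le; lra); lra.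
Qed.

Lemma cps_one_coef s : cps one_coef s = 1.
Proof.
  assert (H : forall a : nat -> R, (forall n, (0 < n)%nat -> a n = 0%R) ->
    PSeries a s = a 0%nat).
  { intros a Ha; unfold PSeries.
    rewrite (is_series_unique _ _ (is_series_finite (V := R_NormedModule)
      (fun k => a k * s ^ k)%R 0
      (fun k Hk => eq_trans (f_equal (fun y => y * s ^ k)%R (Ha k Hk))
                     (Rmult_0_l _)))).
    rewrite sum_O; simpl; apply Rmult_1_r. }
  unfold cps; rewrite !H; [easy | |]; intros [|n] Hn; (easy || inversion Hn).
Qed.

Lemma one_coef_pow n z : one_coef n * Cpow z n = one_coef n.
Proof. destruct n; simpl; cring. Qed.

(** Here [a], [p], [m] stand for [A], [q_+], [q_-]. Over the common denominator [p m = a^2], the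
    logarithmic derivative of [p^g0 m^g1] becomes [z (g0 + ginf t p) / a], by
    [t p + (1 - t) m = 1]. *)
Lemma log_derivative_cancel (z t g0 ginf a p m g e : C) :
  a <> 0 -> p <> 0 -> m <> 0 -> a * a = p * m -> t * p + (1 - t) * m = 1 ->
  z * (g0 + ginf * t * p) * g / a * e
  + g * (e * (- g0 * (z * (1 - t) * a / p) + - (- g0 - ginf) * (- (z * t) * a / m))) = 0.
Proof.
  intros Ha Hp Hm Hapm Hpm.
  transitivity (e * g * z / a *
    (g0 + ginf * (t * p) - (a * a) / (p * m)
     * (g0 * (t * p + (1 - t) * m) + ginf * (t * p)))).
  - field; repeat split; assumption.
  - rewrite Hapm, Hpm; field; repeat split; assumption.
Qed.

Section Path.

Variables t z g0 ginf : C.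

(** Coefficients in [s] of [X] at [(t, s z)], so that [cps (zser X)] follows the segment from [0] to
    [z]. *)
Definition zser (X : nat -> C -> C) (n : nat) : C := X n t * Cpow z n.

Definition geom_bounded (X : nat -> C -> C) : Prop :=
  forall n, (Cmod (zser X n) <= (1/4) ^ n)%R.

Local Notation A := (cps (zser acf)).
Local Notation P := (cps (zser (egf 1 (-1)))).
Local Notation M := (cps (zser (egf 0 (-1)))).
Local Notation G := (cps (zser (egf g0 ginf))).

Hypothesis HA : geom_bounded acf.
Hypothesis HP : geom_bounded (egf 1 (-1)).
Hypothesis HM : geom_bounded (egf 0 (-1)).
Hypothesis HG : geom_bounded (egf g0 ginf).

Lemma Rabs_unit s : (0 <= s <= 1)%R -> (Rabs s <= 1)%R.
Proof. intros Hs; rewrite Rabs_pos_eq; lra. Qed.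

Lemma geom_bounded_in_disk X s :
  geom_bounded X -> (0 <= s <= 1)%R -> in_disk (zser X) s.
Proof.
  intros HX Hs; apply (in_disk_geom _ 1); [|now apply Rabs_unit].
  intros n; rewrite Rmult_1_l; apply HX.
Qed.

Local Hint Resolve geom_bounded_in_disk in_disk_pconv Rabs_unit
  in_disk_one_coef : core.

Lemma zser_egf_O h0 hinf : zser (egf h0 hinf) 0 = 1.
Proof. unfold zser; rewrite egf_O; simpl; cring. Qed.

Lemma zser_acf_O : zser acf 0 = 1.
Proof. unfold zser, acf, factC; simpl; field. Qed.

Lemma cder_zser X n : cder (zser X) n = z * (dz X n t * Cpow z n).
Proof. unfold cder, zser, dz; rewrite Cpow_S; cring. Qed.

Lemma cps_affine c d X s :
  (0 <= s <= 1)%R -> geom_bounded X ->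
  cps (fun n => c * one_coef n + d * zser X n) s = c + d * cps (zser X) s.
Proof.
  intros Hs HX; rewrite cps_plus by (apply pconv_scal; auto).
  rewrite !cps_scal by auto; rewrite cps_one_coef; cring.
Qed.

Lemma rc_derive_zser X s :
  (0 <= s <= 1)%R -> geom_bounded X ->
  rc_derive (cps (zser X)) s (cps (cder (zser X)) s).
Proof. intros Hs HX; apply rc_derive_cps; auto. Qed.

Lemma rc_derive_P s : (0 <= s <= 1)%R -> rc_derive P s (z * (1 - t) * A s).
Proof.
  intros Hs; apply rc_derive_eq with (2 := rc_derive_zser _ s Hs HP).
  rewrite <- cps_scal by auto; apply cps_ext; intros n.
  rewrite cder_zser, dz_egf_qp; unfold zser; cring.
Qed.

Lemma rc_derive_M s : (0 <= s <= 1)%R -> rc_derive M s (- (z * t) * A s).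
Proof.
  intros Hs; apply rc_derive_eq with (2 := rc_derive_zser _ s Hs HM).
  rewrite <- cps_scal by auto; apply cps_ext; intros n.
  rewrite cder_zser, dz_egf_qm; unfold zser; cring.
Qed.

Lemma rc_derive_A s : (0 <= s <= 1)%R -> rc_derive A s (z * (1/2 - t * P s)).
Proof.
  intros Hs; apply rc_derive_eq with (2 := rc_derive_zser _ s Hs HA).
  transitivity (z * (1/2) + - (z * t) * P s); [|cring].
  rewrite <- cps_affine by auto; apply cps_ext; intros n.
  rewrite cder_zser, dz_acf; unfold zser.
  rewrite <- (one_coef_pow n z) at 2; cring.
Qed.

(** The two terms have derivatives [z t (1 - t) A] and its opposite. *)
Lemma tP_plus_M s : (0 <= s <= 1)%R -> t * P s + (1 - t) * M s = 1.
Proof.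
  intros Hs.
  rewrite (rc_derive_0_const (fun r => t * P r + (1 - t) * M r)) with (2 := Hs).
  - rewrite !cps_0, !zser_egf_O; cring.
  - intros r Hr; eapply rc_derive_eq;
      [|apply rc_derive_plus; apply rc_derive_scal;
        [apply (rc_derive_P r Hr) | apply (rc_derive_M r Hr)]].
    cring.
Qed.

(** [A^2 - P M] starts at [0] and has derivative [z A (1 - t P - (1 - t) M)], which is zero by
    [tP_plus_M]. *)
Lemma A_sqr s : (0 <= s <= 1)%R -> A s * A s = P s * M s.
Proof.
  intros Hs.
  assert (H : A s * A s + (-(1)) * (P s * M s) = 0).
  { rewrite (rc_derive_0_const (fun r => A r * A r + (-(1)) * (P r * M r)))
      with (2 := Hs).
    - rewrite !cps_0, !zser_egf_O, zser_acf_O; cring.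
    - intros r Hr; eapply rc_derive_eq;
        [|apply rc_derive_plus; [|apply rc_derive_scal]; apply rc_derive_mult;
          [apply (rc_derive_A r Hr) | apply (rc_derive_A r Hr)
          |apply (rc_derive_P r Hr) | apply (rc_derive_M r Hr)]].
      simpl.
      transitivity (z * A r * (1 - (t * P r + (1 - t) * M r))); [field|].
      rewrite tP_plus_M by easy; cring. }
  transitivity (A s * A s + (-(1)) * (P s * M s) + P s * M s); [cring|].
  rewrite H; cring.
Qed.

(** This is [egf_ode] summed at [s z]; the factor [z] is the derivative of [s z] in [s]. *)
Lemma G_ode s :
  (0 <= s <= 1)%R ->
  A s * cps (cder (zser (egf g0 ginf))) s = z * (g0 + ginf * t * P s) * G s.
Proof.
  intros Hs.
  rewrite <- cps_conv by (auto using in_disk_cder).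
  set (b n := g0 * one_coef n + ginf * t * zser (egf 1 (-1)) n).
  assert (Hb : in_disk b s).
  { apply (in_disk_geom _ (Cmod g0 + Cmod (ginf * t))); [|auto]; intros n.
    unfold b; eapply Rle_trans; [apply Cmod_triangle|].
    rewrite (Cmod_mult g0), (Cmod_mult (ginf * t)), Rmult_plus_distr_r.
    apply Rplus_le_compat; apply Rmult_le_compat_l; try apply Cmod_ge_0.
    - destruct n; simpl; [rewrite Cmod_1; lra | rewrite Cmod_0].
      assert (0 <= (1/4) ^ n)%R by (apply pow_le; lra); lra.
    - apply HP. }
  transitivity (z * (cps b s * G s)).
  - rewrite <- cps_conv, <- cps_scal by (auto using pconv_conv).
    apply cps_ext; intros n.
    assert (E := egf_ode g0 ginf n t); unfold conv in *.
    transitivity (z * Cpow z n * csum (fun k => acf k t * dz (egf g0 ginf) (n - k) t) n).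
    + rewrite <- csum_mult_l; apply csum_ext; intros k Hk.
      rewrite cder_zser; unfold zser.
      (* The power of [z] is distributed over the two factors of the Cauchy product. *)
      replace (Cpow z n) with (Cpow z k * Cpow z (n - k)); [cring|].
      rewrite <- Cpow_add_r; f_equal; lia.
    + rewrite E, <- !csum_mult_l; apply csum_ext; intros k Hk.
      unfold bcoef, b, zser; rewrite <- (one_coef_pow k z) at 2.
      replace (Cpow z n) with (Cpow z k * Cpow z (n - k)); [cring|].
      rewrite <- Cpow_add_r; f_equal; lia.
  - unfold b; rewrite cps_affine by auto; cring.
Qed.

Lemma Re_pos_neq_0 (c : C) : (0 < Re c)%R -> c <> 0.
Proof. intros H E; rewrite E in H; simpl in H; lra. Qed.

Lemma Re_P_pos s : (0 <= s <= 1)%R -> (0 < Re (P s))%R.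
Proof. now apply Re_cps_pos; [|apply zser_egf_O]. Qed.

Lemma Re_M_pos s : (0 <= s <= 1)%R -> (0 < Re (M s))%R.
Proof. now apply Re_cps_pos; [|apply zser_egf_O]. Qed.

(** [G P^(-g0) M^(-g1)] is constant along the segment and equals [1] at its start; positive real
    parts of [P] and [M] make the principal powers differentiable. *)
Lemma G_closed_form :
  G 1 = cpow (P 1) g0 * cpow (M 1) (- g0 - ginf).
Proof.
  set (g1 := - g0 - ginf).
  assert (H1 : (0 <= 1 <= 1)%R) by lra.
  set (L r := (- g0) * Clog (P r) + (- g1) * Clog (M r)).
  assert (Hconst : G 1 * cexp (L 1%R) = 1).
  { rewrite (rc_derive_0_const (fun r => G r * cexp (L r))) with (2 := H1).
    - unfold L; rewrite !cps_0, !zser_egf_O.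
      replace (Clog 1) with (RtoC 0).
      + replace (- g0 * 0 + - g1 * 0) with (RtoC 0) by cring.
        rewrite cexp_0; cring.
      + unfold Clog, Arg; rewrite Cmod_1, ln_1; simpl.
        destruct (Rlt_dec 0 1); [|lra].
        unfold Rdiv; rewrite Rmult_0_l, atan_0; easy.
    - intros r Hr.
      assert (HPr := Re_P_pos r Hr); assert (HMr := Re_M_pos r Hr).
      assert (HP0 := Re_pos_neq_0 _ HPr); assert (HM0 := Re_pos_neq_0 _ HMr).
      assert (HAA := A_sqr r Hr).
      (* Division by [A] is legitimate because [A^2 = P M] and neither factor vanishes. *)
      assert (HA0 : A r <> 0).
      { intros E; rewrite E, Cmult_0_l in HAA.
        now apply (Cmult_neq_0 _ _ HP0 HM0). }
      eapply rc_derive_eq;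
        [|apply rc_derive_mult;
          [apply (rc_derive_zser _ r Hr HG)
          |apply rc_derive_cexp, rc_derive_plus; apply rc_derive_scal, rc_derive_Clog;
           [exact HPr | apply (rc_derive_P r Hr) | exact HMr | apply (rc_derive_M r Hr)]]].
      fold (L r); simpl.
      assert (HG' : cps (cder (zser (egf g0 ginf))) r
                    = z * (g0 + ginf * t * P r) * G r / A r).
      { rewrite <- G_ode by easy; field; exact HA0. }
      rewrite HG'; apply log_derivative_cancel; auto using tP_plus_M. }
  unfold cpow.
  destruct (Ceq_dec (P 1) 0) as [E|_]; [now apply Re_pos_neq_0 in E; auto using Re_P_pos|].
  destruct (Ceq_dec (M 1) 0) as [E|_]; [now apply Re_pos_neq_0 in E; auto using Re_M_pos|].
  rewrite <- cexp_plus.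
  transitivity (G 1 * (cexp (L 1%R) * cexp (- L 1%R))).
  - rewrite cexp_opp_r; cring.
  - rewrite Cmult_assoc, Hconst, Cmult_1_l; f_equal; unfold L; cring.
Qed.

(* The path [s -> (1/2 - t P, q A)] rotates with angular velocity [z q]. *)
Lemma rotation (e : C) :
  let q := csqrt (t * (1 - t)) in
  e * e = -(1) ->
  1/2 - t * P 1 + e * (q * A 1) = (1/2 - t + e * q) * cexp (e * (z * q)).
Proof.
  intros q He.
  assert (Hq : q * q = t * (1 - t)) by apply csqrt_sqr.
  assert (H1 : (0 <= 1 <= 1)%R) by lra.
  (* [Y' = e z q Y], because [e^2 q^2 = - t (1 - t)]; hence [Y] times [exp (- e z q s)] is
     constant. *)
  set (Y r := 1/2 + (- t * P r + e * q * A r)).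
  assert (Hconst : Y 1%R * cexp (- (e * (z * q))) = 1/2 - t + e * q).
  { transitivity (Y 1%R * cexp (- (e * (z * q)) * RtoC 1)).
    - f_equal; f_equal; cring.
    - rewrite (rc_derive_0_const (fun r => Y r * cexp (- (e * (z * q)) * RtoC r)))
        with (2 := H1).
      + unfold Y; rewrite !cps_0, zser_egf_O, zser_acf_O.
        rewrite Cmult_0_r, cexp_0; cring.
      + intros r Hr; eapply rc_derive_eq;
          [|apply rc_derive_mult;
            [apply rc_derive_plus;
              [apply rc_derive_const
              |apply rc_derive_plus; apply rc_derive_scal;
               [apply (rc_derive_P r Hr) | apply (rc_derive_A r Hr)]]
            |apply rc_derive_cexp, rc_derive_scal, rc_derive_id]].
        simpl; unfold Y.
        transitivity (cexp (- (e * (z * q)) * r) *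
          (- (t * (1 - t)) * z * A r - (e * e) * (q * q) * z * A r)); [field|].
        rewrite He, Hq; cring. }
  transitivity (Y 1%R * (cexp (- (e * (z * q))) * cexp (- - (e * (z * q))))).
  - rewrite cexp_opp_r; unfold Y; cring.
  - rewrite Cmult_assoc, Hconst; f_equal; f_equal; cring.
Qed.

(** Averaging [rotation] over [e = Ci] and [e = - Ci] eliminates [A] and turns the exponentials of
    [sp_alt] into [1/2 - t P]. *)
Lemma sp_series : (Re t < 1)%R -> sp t z = t * P 1.
Proof.
  intros Ht; rewrite sp_alt by easy.
  set (q := csqrt (t * (1 - t))).
  assert (R1 := rotation Ci Ci_sqr).
  assert (R2 := rotation (- Ci)); fold q in R1, R2.
  simpl in R1, R2; specialize (R2 ltac:(rewrite <- Ci_sqr; cring)).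
  replace (- (Ci * (z * q))) with (- Ci * (z * q)) by cring.
  rewrite <- R1; replace (1/2 - t - Ci * q) with (1/2 - t + - Ci * q) by cring.
  rewrite <- R2; field.
Qed.

Lemma sm_series : (Re t < 1)%R -> sm t z = (1 - t) * M 1.
Proof.
  intros Ht; assert (H1 : (0 <= 1 <= 1)%R) by lra.
  transitivity (sp t z + sm t z - sp t z); [cring|].
  rewrite sp_sm_sum, sp_series by easy.
  transitivity (t * P 1 + (1 - t) * M 1 - t * P 1); [|cring].
  now rewrite tP_plus_M by easy.
Qed.

End Path.

(** * Absolute convergence of the double series and the closed form near the origin *)

Lemma dps_sum_egf g0 ginf K t z :
  (4 + Cmod g0 + Cmod ginf <= K)%R -> (Cmod t <= 1)%R -> (K * Cmod z <= 1/4)%R ->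
  dps_sum (tcoef g0 ginf) t z (cps (zser t z (egf g0 ginf)) 1).
Proof.
  intros HK Ht Hz.
  assert (Hz0 := Cmod_ge_0 z); assert (H0 := Cmod_ge_0 g0); assert (H1 := Cmod_ge_0 ginf).
  split.
  - exists (fun n => sum_n (fun k => Cmod (tcoef g0 ginf n k) * Cmod t ^ k * Cmod z ^ n)%R n).
    split.
    + intros n; apply (is_series_finite (V := R_NormedModule)); intros k Hk.
      rewrite tcoef_above, Cmod_0 by easy; unfold zero; simpl; ring.
    + apply (ex_series_le (V := R_CompleteNormedModule) _ (fun n => (K * Cmod z) ^ n)%R).
      * intros n; unfold norm; simpl; unfold abs; simpl.
        rewrite Rabs_pos_eq.
        -- apply sum_tcoef_bound; [easy | split; [apply Cmod_ge_0 | easy] | easy].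
        -- replace 0%R with (sum_n (fun _ => 0%R) n)
             by (rewrite sum_n_const; apply Rmult_0_r).
           apply sum_n_m_le; intros k.
           apply Rmult_le_pos; [apply Rmult_le_pos|];
             [apply Cmod_ge_0 | apply pow_le, Cmod_ge_0 | now apply pow_le].
      * apply ex_series_geom; rewrite Rabs_pos_eq; nra.
  - exists (zser t z (egf g0 ginf)); split.
    + intros n; unfold zser; rewrite egf_tcoef.
      apply (is_series_finite (V := C_NormedModule)); intros k Hk.
      rewrite tcoef_above by easy; change (0 * Cpow t k * Cpow z n = 0); cring.
    + apply is_series_cps, (in_disk_geom _ 1); [|rewrite Rabs_R1; lra].
      intros n; rewrite Rmult_1_l; unfold zser.
      eapply Rle_trans; [now apply egf_bound with (M := K)|].
      apply pow_incr; split; [nra | easy].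
Qed.

Theorem mainTheorem6 (g0 ginf : C) :
  let g1 := - g0 - ginf in
  let T := gkp (- (1/2)) 1 g0 1 (-1) ginf in
  (forall t z : C, sp t z + sm t z = 1) /\
  exists (eps : R) (ap am : nat -> nat -> C), (0 < eps)%R /\
    forall t z : C, (Cmod t < eps)%R -> (Cmod z < eps)%R ->
      exists qp qm : C,
        dps_sum ap t z qp /\ dps_sum am t z qm /\
        (tp t <> 0 -> qp = sp t z / tp t) /\
        (tm t <> 0 -> qm = sm t z / tm t) /\
        (z = 0 -> qp = 1 /\ qm = 1) /\
        is_series (egf_term T t z) (cpow qp g0 * cpow qm g1).
Proof.
  intros g1 T; split; [exact sp_sm_sum|].
  assert (H0 := Cmod_ge_0 g0); assert (H1 := Cmod_ge_0 ginf).
  (* One constant serves all three triangles: [q_+], with parameters [(1, -1)], already demands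
     [4 + 1 + 1 = 6]. *)
  set (K := (6 + Cmod g0 + Cmod ginf)%R).
  (* The radius gives [K |z| <= 1/4], the ratio used along the segment; as [K >= 6], it also gives
     [|t| <= 1/2] and [Re t < 1]. *)
  exists (/ (4 * K))%R, (tcoef 1 (-1)), (tcoef 0 (-1)).
  assert (HK : (0 < / (4 * K))%R) by (apply Rinv_0_lt_compat; unfold K; lra).
  split; [easy|]; intros t z Ht Hz.
  assert (Hz' : (K * Cmod z <= 1/4)%R).
  { replace (1/4)%R with (K * / (4 * K))%R by (field; unfold K; lra).
    apply Rmult_le_compat_l; [unfold K; lra | now apply Rlt_le]. }
  assert (Ht' : (Cmod t <= 1/2)%R).
  { eapply Rle_trans; [apply Rlt_le, Ht|].
    replace (1/2)%R with (/ 2)%R by lra; apply Rinv_le_contravar; unfold K; lra. }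
  assert (HRe : (Re t < 1)%R)
    by (generalize (re_le_Cmod t) (Rle_abs (Re t)); lra).
  assert (Hm1 : Cmod (-1) = 1%R) by (rewrite Cmod_R, Rabs_left; lra).
  assert (Kp : (4 + Cmod 1 + Cmod (-1) <= K)%R)
    by (rewrite Cmod_1, Hm1; unfold K; lra).
  assert (Km : (4 + Cmod 0 + Cmod (-1) <= K)%R)
    by (rewrite Cmod_0, Hm1; unfold K; lra).
  assert (Kg : (4 + Cmod g0 + Cmod ginf <= K)%R) by (unfold K; lra).
  assert (Hz0 := Cmod_ge_0 z).
  assert (Hegf : forall h0 hinf, (4 + Cmod h0 + Cmod hinf <= K)%R ->
    geom_bounded t z (egf h0 hinf)).
  { intros h0 hinf Hh n; unfold zser.
    eapply Rle_trans; [apply (egf_bound _ _ K); [easy | lra]|].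
    apply pow_incr; split; [unfold K in *; nra | easy]. }
  assert (HA : geom_bounded t z acf).
  { intros n; unfold zser; eapply Rle_trans; [now apply acf_bound|].
    apply pow_incr; split; [easy | unfold K in *; nra]. }
  assert (HP := Hegf _ _ Kp); assert (HM := Hegf _ _ Km); assert (HG := Hegf _ _ Kg).
  exists (cps (zser t z (egf 1 (-1))) 1), (cps (zser t z (egf 0 (-1))) 1).
  split; [apply (dps_sum_egf _ _ K); [easy | lra | easy]|].
  split; [apply (dps_sum_egf _ _ K); [easy | lra | easy]|].
  split; [|split; [|split]].
  - unfold tp; intros Hn; rewrite sp_series by easy; field; exact Hn.
  - unfold tm; intros Hn; rewrite sm_series by easy; field; exact Hn.
  (* For [z = 0] the derivatives of [P] and [M] along the segment vanish, so their values at [s = 1]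
     are those at [s = 0]. *)
  - intros E.
    assert (HI : (0 <= 1 <= 1)%R) by lra.
    split.
    + rewrite (rc_derive_0_const (cps (zser t z (egf 1 (-1))))) with (2 := HI);
        [rewrite cps_0; apply zser_egf_O|].
      intros s Hs; apply rc_derive_eq with (2 := rc_derive_P t z HA HP s Hs).
      rewrite E; cring.
    + rewrite (rc_derive_0_const (cps (zser t z (egf 0 (-1))))) with (2 := HI);
        [rewrite cps_0; apply zser_egf_O|].
      intros s Hs; apply rc_derive_eq with (2 := rc_derive_M t z HA HM s Hs).
      rewrite E; cring.
  - unfold g1; rewrite <- G_closed_form by easy.
    apply (is_series_ext (zser t z (egf g0 ginf))).
    + intros n; unfold zser, egf, egf_term, row, T.
      fold (factC n); unfold Cdiv.
      change (@sum_n _) with (@sum_n C_AbelianMonoid); cring.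
    + apply is_series_cps, geom_bounded_in_disk; [easy | lra].
Qed.
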